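(* There exist absolute constants $c_1,c_2>0$ and $n_0\in\mathbb{N}$ such that the following holds. Let $n\geq n_0$, let $\mu,\nu$ be isotropic log-concave probability measures on $\mathbb{R}^n$, let $X_1,X_2,\ldots$ be independent random points distributed according to $\mu$, and for $N>n$ let $K_N=\mathrm{conv}\{X_1,\ldots,X_N\}$. Then for every $N>n$ with $N\leq \exp(c_1n/L_\nu^2)$, $$\mathbb{E}_{\mu^N}(\nu(K_N))\leq 2\exp\left(-c_2n/L_\nu^2\right).$$
   Context: A log-concave probability measure on $\mathbb{R}^n$ is a Borel probability measure $\mu$ such that $\mu(\lambda A+(1-\lambda)B)\geq \mu(A)^{\lambda}\mu(B)^{1-\lambda}$ for all compact $A,B$ and $\lambda\in(0,1)$, and $\mu(H)<1$ for every hyperplane $H$; it has a density $f_\mu$. It is isotropic if its barycenter is $0$ and its covariance matrix is the identity. For isotropic $\nu$ the isotropic constant is $L_\nu=\|f_\nu\|_\infty^{1/n}$. *)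

(* Defs.v *)
From HB Require Import structures.
From mathcomp Require Import all_boot all_order all_algebra.
From mathcomp Require Import all_classical all_reals all_analysis.
From mathcomp Require Import ess_sup_inf.
Set Implicit Arguments. Unset Strict Implicit. Unset Printing Implicit Defensive.
Import Order.TTheory GRing.Theory Num.Theory.
Import numFieldNormedType.Exports.
Local Open Scope classical_set_scope.
Local Open Scope ring_scope.

Definition Rn (R : realType) (n : nat) : Type :=
  g_sigma_algebraType (@open 'rV[R]_n).

Definition dotRn (R : realType) (n : nat) (x y : 'rV[R]_n) : R :=
  \sum_(i < n) x ord0 i * y ord0 i.

(* lam is the Lebesgue measure on R^n: it gives every closed box its volume.
   (This determines a Borel measure uniquely.) *)
Definition is_lebesgue_Rn (R : realType) (n : nat)
    (lam : {measure set (Rn R n) -> \bar R}) : Prop :=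
  forall a b : 'rV[R]_n, (forall i, a ord0 i <= b ord0 i) ->
    lam [set x : Rn R n | forall i, a ord0 i <= (x : 'rV[R]_n) ord0 i <= b ord0 i]
    = (\prod_(i < n) (b ord0 i - a ord0 i))%:E.

Definition mink_comb (R : realType) (n : nat) (t : R) (A B : set 'rV[R]_n)
  : set 'rV[R]_n :=
  [set t *: a + (1 - t) *: b | a in A & b in B].

Definition is_hyperplane (R : realType) (n : nat) (H : set 'rV[R]_n) : Prop :=
  exists (u : 'rV[R]_n) (c : R), u != 0 /\ H = [set x | dotRn x u = c].

Definition log_concave (R : realType) (n : nat) (mu : probability (Rn R n) R)
  : Prop :=
  (forall (A B : set 'rV[R]_n) (t : R), compact A -> compact B ->
     0 < t < 1 ->
     powR (fine (mu A)) t * powR (fine (mu B)) (1 - t)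
       <= fine (mu (mink_comb t A B))) /\
  (forall H : set 'rV[R]_n, is_hyperplane H -> (mu H < 1)%E).

Definition isotropic (R : realType) (n : nat) (mu : probability (Rn R n) R)
  : Prop :=
  (forall i : 'I_n,
     mu.-integrable setT (fun x : Rn R n => ((x : 'rV[R]_n) ord0 i)%:E) /\
     (\int[mu]_x ((x : 'rV[R]_n) ord0 i)%:E = 0)%E) /\
  (forall i j : 'I_n,
     mu.-integrable setT
       (fun x : Rn R n => ((x : 'rV[R]_n) ord0 i * (x : 'rV[R]_n) ord0 j)%:E) /\
     (\int[mu]_x ((x : 'rV[R]_n) ord0 i * (x : 'rV[R]_n) ord0 j)%:E
        = (i == j)%:R%:E)%E).

Definition is_density (R : realType) (n : nat)
    (lam : {measure set (Rn R n) -> \bar R}) (nu : probability (Rn R n) R)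
    (f : Rn R n -> R) : Prop :=
  measurable_fun setT f /\ (forall x, 0 <= f x) /\
  forall A : set (Rn R n), measurable A ->
    nu A = (\int[lam]_(x in A) (f x)%:E)%E.

Definition isotropic_constant (R : realType) (n : nat)
    (lam : {measure set (Rn R n) -> \bar R}) (f : Rn R n -> R) : R :=
  powR (fine (ess_sup lam (fun x => (f x)%:E))) (n%:R^-1).

Definition mutually_independent (R : realType) (n : nat) d
    (Omega : measurableType d) (P : probability Omega R)
    (X : nat -> Omega -> Rn R n) : Prop :=
  forall (I : seq nat) (A : nat -> set (Rn R n)), uniq I ->
    (forall i, i \in I -> measurable (A i)) ->
    fine (P (\big[setI/setT]_(i <- I) (X i @^-1` A i)))
      = \prod_(i <- I) fine (P (X i @^-1` A i)).

Definition distributed_as (R : realType) (n : nat) d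
    (Omega : measurableType d) (P : probability Omega R)
    (X : Omega -> Rn R n) (mu : probability (Rn R n) R) : Prop :=
  measurable_fun setT X /\
  forall A : set (Rn R n), measurable A -> P (X @^-1` A) = mu A.

Definition conv_hull (R : realType) (n N : nat) (p : 'I_N -> 'rV[R]_n)
  : set (Rn R n) :=
  [set x | exists w : 'I_N -> R, (forall i, 0 <= w i) /\
     \sum_(i < N) w i = 1 /\ (x : 'rV[R]_n) = \sum_(i < N) w i *: p i].

(* Main.v *)
Require Import Defs.
From HB Require Import structures.
From mathcomp Require Import all_boot all_order all_algebra.
From mathcomp Require Import all_classical all_reals all_analysis.
From mathcomp Require Import measurable_realfun ess_sup_inf.
From mathcomp Require Import ring lra zify.
Import Order.TTheory GRing.Theory Num.Theory.
Import numFieldNormedType.Exports.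
Local Open Scope classical_set_scope.
Local Open Scope ring_scope.

Set Implicit Arguments.
Unset Strict Implicit.
Unset Printing Implicit Defensive.

(** If a point [x] lies in the convex hull of [X_1, ..., X_N], then every
    halfspace containing [x] contains some [X_i]; hence the expected measure is
    controlled by the points [x] that lie in no halfspace of [mu]-measure at
    most [exp (- n / S)], where [S = 2 ^ m] is of the order of [L ^ 2].

    Let [W] be the law of a sum of [S] independent copies of [mu].  If [H] is a
    halfspace, then [mu H ^ S <= W (S H)].  The measure [W] is again
    log-concave, and it lives at scale [sqrt S].  Let [F x] be the [W]-measure
    of a box of side of order [sqrt S] around [x].  Then [F] is log-concave, so
    that [C = {F >= a ^ n}] is convex, and a point outside [C] is separated
    from [C] by a halfspace on which [F] is small.  Such a halfspace has
    [W]-measure at most [exp (- n)]: a second moment bound gives a lattice point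
    [z0] with [F z0 >= b ^ n], and [sqrt (F z * F z0) <= F ((z + z0) / 2)] makes
    the sum of [sqrt F] over the lattice at most exponential in [n].  Counting
    boxes, the volume of [C / S] is at most [(K / sqrt S) ^ n], so its
    [nu]-measure is at most [(K L / sqrt S) ^ n]. *)

(** * Borel measurability in [R^n] *)

Lemma measurable_forall d (T : measurableType d) (I : finType)
    (A : I -> set T) :
  (forall i, measurable (A i)) -> measurable [set t | forall i, A i t].
Proof.
move=> mA; have -> : [set t | forall i, A i t] = \bigcap_(i in setT) A i.
  by apply/seteqP; split => t /= h i; [move=> _; exact: h|exact: h].
by apply: fin_bigcap_measurable => // ; exact: finite_finset.
Qed.

Section borel_Rn.
Context {R : realType} {n : nat}.
Implicit Types (A : set 'rV[R]_n).

Lemma open_measurable_Rn A : open A -> measurable (A : set (Rn R n)).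
Proof. by move=> oA; exact: sub_sigma_algebra. Qed.

Lemma closed_measurable_Rn A : closed A -> measurable (A : set (Rn R n)).
Proof.
move=> cA; rewrite -(setCK A); apply: measurableC.
by apply: open_measurable_Rn; exact: closed_openC.
Qed.

Lemma compact_measurable_Rn A : compact A -> measurable (A : set (Rn R n)).
Proof.
by move=> cA; apply: closed_measurable_Rn; apply: compact_closed => //;
  exact: norm_hausdorff.
Qed.

Lemma continuous_measurable_Rn (f : 'rV[R]_n -> R) :
  continuous f -> measurable_fun setT (f : Rn R n -> R).
Proof.
move=> cf; apply: (measurability _ (RGenOpens.measurableE R)) => _ [_ [a [b ->]] <-].
rewrite setTI; apply: open_measurable_Rn.
by apply: open_comp => [x _|]; [exact: cf|exact: interval_open].
Qed.

Lemma coord_measurable_Rn (i : 'I_n) :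
  measurable_fun setT (fun x : Rn R n => (x : 'rV[R]_n) ord0 i).
Proof. by apply: continuous_measurable_Rn; exact: coord_continuous. Qed.

Lemma dotRn_continuous (u : 'rV[R]_n) : continuous (fun x => dotRn x u).
Proof.
apply: continuous_big => [|i _]; first exact: add_continuous.
by move=> x; apply: continuousM; [exact: coord_continuous|exact: cst_continuous].
Qed.

Lemma ball_rVE (x y : 'rV[R]_n) e : 0 < e ->
  ball x e y <-> forall i, `|x ord0 i - y ord0 i| < e.
Proof.
move=> e0; split => [[_ h] i|h]; first exact: h.
by split => // i j; rewrite ord1; exact: h.
Qed.

(** An open set is a countable union of boxes with rational centre and half-side [1 / (k + 1)], and
    the preimage of a box is cut out by the coordinates. This handles addition on [Rn * Rn], which
    carries the product sigma-algebra. *)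
Lemma measurable_fun_Rn d (T : measurableType d) (f : T -> Rn R n) :
  (forall i, measurable_fun setT (fun t => (f t : 'rV[R]_n) ord0 i)) ->
  measurable_fun setT f.
Proof.
move=> mf; apply: (@measurability _ _ T (Rn R n) setT f
  (@open 'rV[R]_n : set (set (Rn R n))) erefl) => _ [U oU <-].
rewrite setTI.
pose bx (q : 'rV[rat]_n * nat) : set 'rV[R]_n :=
  [set y | forall i, `|ratr (q.1 ord0 i) - y ord0 i| < q.2.+1%:R^-1].
have -> : f @^-1` U = \bigcup_q
    (if `[< bx q `<=` U >] then f @^-1` bx q else set0).
  apply/seteqP; split => [t Ut|t [q _]]; last first.
    by case: asboolP => // qU ft; exact: qU.
  have : nbhs (f t : 'rV[R]_n) U by exact: open_nbhs_nbhs.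
  move=> /nbhs_ballP[e /= e0 eU].
  have e20 : 0 < e / 2 by rewrite divr_gt0.
  pose k := Num.truncn (e / 2)^-1.
  have ke : k.+1%:R^-1 < e / 2.
    by rewrite invf_plt ?posrE ?ltr0n// truncnS_gt.
  have k0 : 0 < k.+1%:R^-1 :> R by rewrite invr_gt0 ltr0n.
  (* The centre is chosen within [1 / (k + 1) < e / 2] of [f t], so that the box contains [f t] and
     stays inside the [e]-ball. *)
  have q_ i : {q : rat | `|ratr q - (f t : 'rV[R]_n) ord0 i| < k.+1%:R^-1}.
    apply/cid; have [|q] := @rat_in_itvoo R ((f t : 'rV[R]_n) ord0 i)
      ((f t : 'rV[R]_n) ord0 i + k.+1%:R^-1).
      by rewrite ltrDl.
    rewrite in_itv/= => /andP[q1 q2]; exists q.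
    by rewrite ger0_norm ?subr_ge0 ?(ltW q1)// ltrBlDl.
  exists (\row_i sval (q_ i), k) => //.
  case: asboolP => [_ i|]; first by rewrite mxE; exact: (svalP (q_ i)).
  case; move=> y /= yb; apply: eU; apply/ball_rVE => // i.
  have := svalP (q_ i); have := yb i; rewrite mxE /=.
  move: (sval (q_ i)) => q h1 h2.
  rewrite -(subrK (ratr q) ((f t : 'rV[R]_n) ord0 i)) -addrA.
  rewrite (le_lt_trans (ler_normD _ _))// distrC.
  by rewrite [ltRHS]splitr ltrD// (lt_trans _ ke).
apply: countable_bigcupT_measurable => // q.
case: asboolP => // _.
apply: (@measurable_forall _ _ _ (fun i => (fun t => (f t : 'rV[R]_n) ord0 i) @^-1`
    (ball (ratr (q.1 ord0 i) : R) q.2.+1%:R^-1))) => i.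
rewrite -[X in measurable X]setTI.
by apply: mf => //; exact: measurable_ball.
Qed.

Lemma addRn_measurable :
  measurable_fun setT (fun p : Rn R n * Rn R n => ((p.1 : 'rV[R]_n) + p.2 : Rn R n)).
Proof.
apply: measurable_fun_Rn => i.
rewrite (_ : (fun _ => _) = (fun p : Rn R n * Rn R n =>
  (p.1 : 'rV[R]_n) ord0 i + (p.2 : 'rV[R]_n) ord0 i)); last first.
  by apply/funext => p; rewrite mxE.
by apply: measurable_funD;
  [apply: (measurableT_comp (@coord_measurable_Rn i) measurable_fst)
  |apply: (measurableT_comp (@coord_measurable_Rn i) measurable_snd)].
Qed.

End borel_Rn.

(** * One-dimensional transport of step functions *)

Section step_functions.
Context {R : realType}.
Implicit Types (F G H I : R -> R) (p q : seq (R * R)).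

Definition blocks_length p := \sum_(b <- p) b.1.
Definition blocks_mass p := \sum_(b <- p) b.1 * b.2.

(* A list [(d1, h1); (d2, h2); ...] is a step function on [0, d1 + d2 + ...]
   read from the right end to the left, the first block being the rightmost. *)
Fixpoint blocks_below F p : Prop :=
  if p is (d, h) :: p' then
    [/\ 0 <= d, 0 <= h, (forall a, 0 < a <= d + blocks_length p' -> h <= F a) &
        blocks_below F p']
  else True.

Lemma blocks_length_cons d h p :
  blocks_length ((d, h) :: p) = d + blocks_length p.
Proof. by rewrite /blocks_length big_cons. Qed.

Lemma blocks_mass_cons d h p :
  blocks_mass ((d, h) :: p) = d * h + blocks_mass p.
Proof. by rewrite /blocks_mass big_cons. Qed.

Lemma blocks_length_ge0 F p : blocks_below F p -> 0 <= blocks_length p.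
Proof.
elim: p => [|[d h] p ih] /=; first by rewrite /blocks_length big_nil.
by case=> d0 _ _ /ih p0; rewrite blocks_length_cons addr_ge0.
Qed.

Lemma blocks_below_shrink F d d' h p : 0 <= d' <= d ->
  blocks_below F ((d, h) :: p) -> blocks_below F ((d', h) :: p).
Proof.
move=> /andP[d'0 d'd] /= [d0 h0 hF pF]; split => // a /andP[a0 ad].
by apply: hF; rewrite a0 (le_trans ad)// lerD2r.
Qed.

(** After squaring this is AM-GM for [a * e] and [d * b]. It bounds from below how far the geometric
    mean of two right ends moves when blocks of lengths [d] and [e] are added. *)
Lemma sqrt_superadditive (a b d e : R) : 0 <= a -> 0 <= b -> 0 <= d -> 0 <= e ->
  Num.sqrt (a * b) + Num.sqrt (d * e) <= Num.sqrt ((d + a) * (e + b)).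
Proof.
move=> a0 b0 d0 e0; rewrite -ler_sqr ?nnegrE ?addr_ge0 ?sqrtr_ge0//.
rewrite sqr_sqrtr ?mulr_ge0 ?addr_ge0// sqrrD !sqr_sqrtr ?mulr_ge0//.
rewrite -sqrtrM ?mulr_ge0//.
have -> : a * b * (d * e) = (a * e) * (d * b) by ring.
rewrite sqrtrM ?mulr_ge0//.
set u := Num.sqrt (a * e); set v := Num.sqrt (d * b).
have u2 : u ^+ 2 = a * e by rewrite sqr_sqrtr// mulr_ge0.
have v2 : v ^+ 2 = d * b by rewrite sqr_sqrtr// mulr_ge0.
have : 0 <= (u - v) ^+ 2 by rewrite sqr_ge0.
by rewrite sqrrB u2 v2 => ?; lra.
Qed.

Section transport.
(** In the application [F], [G], [H] are level functions [a |-> W {f >= a}], and [I c] stands for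
    the integral of [H] over [[0, c]]; [IH] records that [H] is nonincreasing. *)
Variables (F G H I : R -> R).
Hypothesis H0 : forall c, 0 <= H c.
Hypothesis FGH : forall a b, 0 < a -> 0 < b ->
  F a * G b <= H (Num.sqrt (a * b)) ^+ 2.
Hypothesis I0 : 0 <= I 0.
Hypothesis IH : forall c' c, 0 <= c' <= c -> I c' + (c - c') * H c <= I c.

Let I_nd c' c : 0 <= c' <= c -> I c' <= I c.
Proof.
move=> cc; apply: le_trans (IH cc).
by case/andP: cc => c0 cc; rewrite lerDl mulr_ge0// subr_ge0.
Qed.

Let I_ge0 c : 0 <= c -> 0 <= I c.
Proof. by move=> c0; rewrite (le_trans I0)// I_nd ?lexx. Qed.

(** [FGH] at the two right ends gives [H >= sqrt (f * g)] at the new point, and by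
    [sqrt_superadditive] the interval gained has length at least [sqrt (d * e)]. *)
Let I_step a b d e f g : 0 <= a -> 0 <= b -> 0 < d -> 0 < e -> 0 <= f -> 0 <= g ->
  f <= F (d + a) -> g <= G (e + b) ->
  I (Num.sqrt (a * b)) + Num.sqrt (d * e) * Num.sqrt (f * g) <=
  I (Num.sqrt ((d + a) * (e + b))).
Proof.
move=> a0 b0 d0 e0 f0 g0 fF gG.
have sup := sqrt_superadditive a0 b0 (ltW d0) (ltW e0).
have sde := sqrtr_ge0 (d * e).
have cc : 0 <= Num.sqrt (a * b) <= Num.sqrt ((d + a) * (e + b)).
  by rewrite sqrtr_ge0/= (le_trans _ sup)// lerDl.
apply: le_trans (IH cc).
rewrite lerD2l ler_pM ?sqrtr_ge0 ?lerBrDl//.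
rewrite -ler_sqr ?nnegrE ?sqrtr_ge0//.
rewrite sqr_sqrtr ?mulr_ge0//.
apply: le_trans (FGH _ _); first by rewrite ler_pM.
all: by rewrite ltr_wpDr.
Qed.

(* Pieces of equal relative mass are matched from the right end on; a matched
   pair of pieces contributes its geometric mean by [sqrt_superadditive]. *)
Lemma blocks_mass_transport p q r : 0 < r ->
  blocks_below F p -> blocks_below G q -> blocks_mass q = r * blocks_mass p ->
  Num.sqrt r * blocks_mass p <=
  I (Num.sqrt (blocks_length p * blocks_length q)).
Proof.
(* Induction on the total number of blocks: each round uses up a whole block of at least one
   list. *)
move=> r0; have [k] := ubnP (size p + size q)%N.
elim: k p q => // k ih p q.
case: p => [|[d f] p].
  by move=> _ _ _ _; rewrite /blocks_mass big_nil mulr0 I_ge0// sqrtr_ge0.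
case: q => [|[e g] q].
  rewrite [in X in X = _]/blocks_mass big_nil => _ _ _ /esym/eqP.
  by rewrite mulf_eq0 gt_eqF//= => /eqP ->; rewrite mulr0 I_ge0// sqrtr_ge0.
move=> /= sz Fp Gq; have /= [d0 f0 fF Fp'] := Fp; have /= [e0 g0 gG Gq'] := Gq.
have p0 := blocks_length_ge0 Fp'; have q0 := blocks_length_ge0 Gq'.
rewrite !blocks_mass_cons !blocks_length_cons => m.
(* A block without mass is dropped; monotonicity of [I] absorbs the lost length. *)
have [df|df] := eqVneq (d * f) 0.
  apply: le_trans (@I_nd (Num.sqrt (blocks_length p * (e + blocks_length q))) _ _);
    last by rewrite sqrtr_ge0/= ler_wsqrtr// ler_wpM2r ?addr_ge0// lerDr.
  have := ih p ((e, g) :: q); rewrite blocks_mass_cons blocks_length_cons.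
  rewrite m df !add0r /=; apply => //; clear -sz; lia.
have [eg|eg] := eqVneq (e * g) 0.
  apply: le_trans (@I_nd (Num.sqrt ((d + blocks_length p) * blocks_length q)) _ _);
    last by rewrite sqrtr_ge0/= ler_wsqrtr// ler_wpM2l ?addr_ge0// lerDr.
  have := ih ((d, f) :: p) q; rewrite blocks_mass_cons blocks_length_cons.
  rewrite -m eg !add0r /=; apply => //; clear -sz; lia.
have {df} [d0' f0'] : 0 < d /\ 0 < f.
  by move: df; rewrite mulf_eq0 negb_or => /andP[? ?]; rewrite !lt0r; split; apply/andP.
have {eg} [e0' g0'] : 0 < e /\ 0 < g.
  by move: eg; rewrite mulf_eq0 negb_or => /andP[? ?]; rewrite !lt0r; split; apply/andP.
have fF1 : f <= F (d + blocks_length p) by apply: fF; rewrite lexx ltr_wpDr.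
have gG1 : g <= G (e + blocks_length q) by apply: gG; rewrite lexx ltr_wpDr.
have [le|lt] := leP (r * (d * f)) (e * g).
  (* [e'] is the length of the piece of the [q]-block whose mass is [r] times that of the whole
     [p]-block; the remaining [e - e'] is kept for later rounds. *)
  pose e' := r * (d * f) / g.
  have e'0 : 0 < e' by rewrite !divr_gt0 ?mulr_gt0.
  have e'e : e' <= e by rewrite ler_pdivrMr.
  have e'g : e' * g = r * (d * f) by rewrite /e' divfK// gt_eqF.
  have Gq2 : blocks_below G ((e - e', g) :: q).
    by apply: blocks_below_shrink Gq; rewrite subr_ge0 e'e gerBl ltW.
  have := ih p ((e - e', g) :: q); rewrite blocks_mass_cons blocks_length_cons /=.
  move=> /(_ _ Fp' Gq2) h.
  have {}h : Num.sqrt r * blocks_mass p <=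
      I (Num.sqrt (blocks_length p * (e - e' + blocks_length q))).
    by apply: h; [clear -sz; lia|rewrite mulrBl e'g addrAC m mulrDr addrAC subrr add0r].
  have /(_ _) := @I_step (blocks_length p) (e - e' + blocks_length q) d e' f g.
  have -> : e' + (e - e' + blocks_length q) = e + blocks_length q by ring.
  move=> /(_ p0 _ d0' e'0 f0 g0 fF1 gG1) st.
  apply: le_trans (st _); last by rewrite addr_ge0// subr_ge0.
  rewrite mulrDr addrC lerD//.
  rewrite -sqrtrM; last by rewrite mulr_ge0// ltW.
  have -> : d * e' * (f * g) = r * (d * f) ^+ 2.
    by transitivity (d * f * (e' * g)); [ring|rewrite e'g; ring].
  by rewrite (sqrtrM _ (ltW r0)) sqrtr_sqr ger0_norm// mulr_ge0// ltW.
(* Here the [p]-block is the heavier one, so it is cut instead. *)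
pose d' := e * g / (r * f).
have d'0 : 0 < d' by rewrite !divr_gt0 ?mulr_gt0.
have rf0 : 0 < r * f by rewrite mulr_gt0.
have d'd : d' <= d by rewrite ler_pdivrMr// mulrCA ltW.
have d'f : r * (d' * f) = e * g.
  by rewrite mulrCA /d' divfK// gt_eqF.
have Fp2 : blocks_below F ((d - d', f) :: p).
  by apply: blocks_below_shrink Fp; rewrite subr_ge0 d'd gerBl ltW.
have := ih ((d - d', f) :: p) q; rewrite blocks_mass_cons blocks_length_cons /=.
move=> /(_ _ Fp2 Gq') h.
have {}h : Num.sqrt r * ((d - d') * f + blocks_mass p) <=
    I (Num.sqrt ((d - d' + blocks_length p) * blocks_length q)).
  apply: h; first by clear -sz; lia.
  by rewrite mulrDr mulrBl mulrBr d'f addrAC -mulrDr -m addrAC subrr add0r.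
have /(_ _) := @I_step (d - d' + blocks_length p) (blocks_length q) d' e f g.
have -> : d' + (d - d' + blocks_length p) = d + blocks_length p by ring.
move=> /(_ _ q0 d'0 e0' f0 g0 fF1 gG1) st.
apply: le_trans (st _); last by rewrite addr_ge0// subr_ge0.
have -> : Num.sqrt r * (d * f + blocks_mass p) =
  Num.sqrt r * ((d - d') * f + blocks_mass p) + Num.sqrt r * (d' * f) by ring.
rewrite lerD// -sqrtrM; last by rewrite mulr_ge0// ltW.
have -> : d' * e * (f * g) = r * (d' * f) ^+ 2.
  by transitivity (d' * f * (e * g)); [ring|rewrite -d'f; ring].
by rewrite (sqrtrM _ (ltW r0)) sqrtr_sqr ger0_norm// mulr_ge0// ltW.
Qed.

End transport.

Section uniform_blocks.
Variables (F : R -> R) (N : nat).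

(** For nonincreasing [F] this is a lower Riemann sum: each block takes the value of [F] at its
    right end. *)
Fixpoint uniform_blocks k : seq (R * R) :=
  if k is k'.+1 then (N.+1%:R^-1, F (k%:R / N.+1%:R)) :: uniform_blocks k'
  else [::].

Lemma uniform_blocks_length k : blocks_length (uniform_blocks k) = k%:R / N.+1%:R.
Proof.
elim: k => [|k ih]; first by rewrite /blocks_length big_nil mul0r.
by rewrite blocks_length_cons ih -(natr1 k) mulrDl mul1r addrC.
Qed.

Lemma uniform_blocks_mass k :
  blocks_mass (uniform_blocks k) = \sum_(i < k) N.+1%:R^-1 * F (i.+1%:R / N.+1%:R).
Proof.
elim: k => [|k ih]; first by rewrite /blocks_mass big_nil big_ord0.
by rewrite blocks_mass_cons ih big_ord_recr/= addrC.
Qed.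

Lemma uniform_blocks_below k : (forall a, 0 <= F a) ->
  (forall a b, a <= b -> F b <= F a) -> blocks_below F (uniform_blocks k).
Proof.
move=> F0 Fni; elim: k => //= k ih; split => //.
move=> a /andP[_]; rewrite uniform_blocks_length => ak; apply: Fni.
by rewrite -(natr1 k) mulrDl mul1r addrC.
Qed.

End uniform_blocks.

(** The sum is the integer part of [y]. *)
Lemma le_1Dcount (N : nat) (y : R) : 0 <= y <= N%:R ->
  y <= 1 + \sum_(k < N) (k.+1%:R <= y)%R%:R.
Proof.
elim: N => [|N ih] /andP[y0 yN].
  by rewrite big_ord0 addr0 (le_trans yN).
have [yN'|yN'] := leP y N%:R.
  rewrite big_ord_recr/= addrA; apply: (le_trans (ih _)); first by rewrite y0.
  by rewrite lerDl.
rewrite (le_trans yN)// -natr1 addrC lerD2l.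
rewrite big_ord_recr/= -[leLHS]addr0 lerD//.
rewrite (eq_bigr (fun=> 1)) ?sumr_const ?card_ord// => i _.
by rewrite (_ : (_ <= _)) // (le_trans _ (ltW yN'))// ler_nat.
Qed.

End step_functions.

(** * Real-valued probabilities: covers, multiplicities, Markov's inequality *)

Section probability_fine.
Context d (T : measurableType d) (R : realType) (W : probability T R).

Lemma prob_fin_num A : measurable A -> W A \is a fin_num.
Proof. by move=> mA; exact: fin_num_measure. Qed.

Lemma prob_fineK A : measurable A -> (fine (W A))%:E = W A.
Proof. by move=> mA; rewrite fineK// prob_fin_num. Qed.

Lemma fine_prob_ge0 A : 0 <= fine (W A).
Proof. by rewrite fine_ge0. Qed.

Lemma fine_prob_le1 A : measurable A -> fine (W A) <= 1.
Proof. by move=> mA; rewrite -lee_fin prob_fineK// probability_le1. Qed.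

Lemma le_fine_prob A B : measurable A -> measurable B -> A `<=` B ->
  fine (W A) <= fine (W B).
Proof. by move=> mA mB AB; rewrite -lee_fin !prob_fineK// le_measure ?inE. Qed.

Lemma fine_prob_sum_cover (J : finType) (Q : pred J) A (B : J -> set T) :
  measurable A -> (forall j, measurable (B j)) ->
  (forall x, A x -> exists2 j, Q j & B j x) ->
  fine (W A) <= \sum_(j | Q j) fine (W (B j)).
Proof.
move=> mA mB AB; rewrite -lee_fin -sumEFin prob_fineK//.
under eq_bigr do rewrite prob_fineK//.
have mU : measurable (\big[setU/set0]_(j | Q j) B j).
  by apply: bigsetU_measurable.
apply: (@le_trans _ _ (W (\big[setU/set0]_(j | Q j) B j))).
  rewrite le_measure ?inE// => x /AB[j Qj Bx].
  by rewrite (bigD1 j)//=; left.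
elim: (index_enum J) => [|j r ih]; first by rewrite !big_nil measure0.
rewrite !big_cons; case: (Q j) => //.
apply: (le_trans (measureU2 _ _ _)) => //.
  by apply: bigsetU_measurable.
exact: leeD2l.
Qed.

Lemma integral_cst_prob (r : R) : (\int[W]_x (cst r%:E) x = r%:E)%E.
Proof. by rewrite integral_cst//= probability_setT mule1. Qed.

(** The sum is the integral of the multiplicity with which the sets cover a point. *)
Lemma sum_fine_prob_le (J : finType) (Q : pred J) (B : J -> set T) (K : R) :
  (forall j, measurable (B j)) ->
  (forall x, \sum_(j | Q j) (x \in B j)%:R <= K) ->
  \sum_(j | Q j) fine (W (B j)) <= K.
Proof.
move=> mB BK; rewrite -lee_fin -sumEFin.
have K0 : 0 <= K by apply: le_trans (BK point); apply: sumr_ge0.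
rewrite big_mkcond/=.
rewrite (eq_bigr (fun j => \int[W]_x (if Q j then \1_(B j) x else 0)%:E)%E); last first.
  move=> j _; case: (Q j); last by rewrite integral0.
  by rewrite prob_fineK// integral_indic// setIT.
rewrite -ge0_integral_sum//.
all: try (by move=> j; apply/measurable_EFinP; case: (Q j) => //; exact: measurable_indic).
all: try (by move=> j x _; rewrite lee_fin; case: ifP).
apply: (@le_trans _ _ (\int[W]_x (cst K%:E) x)%E).
  apply: ge0_le_integral => //.
  - by move=> x _; apply: sume_ge0 => j _; rewrite lee_fin; case: ifP.
  - apply: emeasurable_sum => j; apply/measurable_EFinP.
    by case: (Q j) => //; exact: measurable_indic.
  - move=> x _ /=; rewrite sumEFin lee_fin (le_trans _ (BK x))//.
    by rewrite [leRHS]big_mkcond.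
by rewrite integral_cst_prob.
Qed.

Lemma markov_ineq (f : T -> R) a : measurable_fun setT f -> (forall x, 0 <= f x) ->
  0 <= a ->
  (a%:E * W [set x | (a <= f x)%R] <= \int[W]_x (f x)%:E)%E.
Proof.
move=> mf f0 a0.
have mA : measurable [set x | a <= f x].
  by rewrite -[X in measurable X]setTI; exact: measurable_fun_le.
rewrite -[X in W X]setIT -integral_indic// -ge0_integralZl//; last first.
  by apply/measurable_EFinP; exact: measurable_indic.
apply: ge0_le_integral => //.
- by move=> x _; rewrite mule_ge0.
- by apply: measurable_funeM; apply/measurable_EFinP; exact: measurable_indic.
- exact/measurable_EFinP.
- move=> x _; rewrite -EFinM lee_fin indicE.
  by case: (boolP (x \in _)); rewrite ?mulr1 ?mulr0// inE.
Qed.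

End probability_fine.

(** * A Prekopa-Leindler inequality for level sets *)

Section prekopa_leindler.
Context d (T : measurableType d) (R : realType) (W : probability T R).
Local Notation E f := (fine (\int[W]_x (f x)%:E)).

Lemma unit_integral_fin_num (f : T -> R) : measurable_fun setT f ->
  (forall x, 0 <= f x <= 1) -> (\int[W]_x (f x)%:E)%E \is a fin_num.
Proof.
move=> mf f01; rewrite ge0_fin_numE; last first.
  by apply: integral_ge0 => x _; rewrite lee_fin; case/andP: (f01 x).
apply: (@le_lt_trans _ _ (\int[W]_x (cst 1%:E) x)%E).
  apply: ge0_le_integral => //.
  - by move=> x _; rewrite lee_fin; case/andP: (f01 x).
  - exact/measurable_EFinP.
  - by move=> x _; rewrite lee_fin; case/andP: (f01 x).
by rewrite integral_cst_prob ltry.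
Qed.

Let level_measurable (f : T -> R) a : measurable_fun setT f ->
  measurable [set x | a <= f x].
Proof. by move=> mf; rewrite -[X in measurable X]setTI; exact: measurable_fun_le. Qed.

Let level (f : T -> R) a := fine (W [set x | a <= f x]).

Let level_ni (f : T -> R) a b : measurable_fun setT f -> a <= b ->
  level f b <= level f a.
Proof.
move=> mf ab; apply: le_fine_prob => [| |x /=]; last exact: le_trans.
- exact: level_measurable.
- exact: level_measurable.
Qed.

(** The layer-cake formula with a Riemann sum: [le_1Dcount] at [(N + 1) * f x] bounds [f] pointwise,
    and integrating the indicators produces the level function. *)
Let integral_le_blocks (f : T -> R) N : measurable_fun setT f ->
  (forall x, 0 <= f x <= 1) ->
  E f <= N.+1%:R^-1 + blocks_mass (uniform_blocks (level f) N N.+1).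
Proof.
move=> mf f01; rewrite -lee_fin fineK ?unit_integral_fin_num//.
rewrite uniform_blocks_mass EFinD.
rewrite (_ : (\sum_(i < _) _)%:E = \int[W]_x (\sum_(i < N.+1)
    N.+1%:R^-1 * \1_([set y | i.+1%:R / N.+1%:R <= f y]) x)%:E)%E; last first.
  rewrite -sumEFin; under [RHS]eq_integral do rewrite -sumEFin.
  rewrite ge0_integral_sum//.
  all: try (by move=> i; apply/measurable_EFinP/measurable_funM => //; apply: measurable_indic; exact: level_measurable).
  all: try (by move=> i x _; rewrite lee_fin mulr_ge0// invr_ge0).
  apply: eq_bigr => i _; under eq_integral do rewrite EFinM.
  rewrite ge0_integralZl//.
  all: try (by apply/measurable_EFinP/measurable_indic; exact: level_measurable).
  all: try (by rewrite lee_fin invr_ge0).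
  rewrite integral_indic// ?setIT; last exact: level_measurable.
  by rewrite EFinM /level prob_fineK//; exact: level_measurable.
have mS : measurable_fun setT (fun x => \sum_(i < N.+1)
    N.+1%:R^-1 * \1_([set y | i.+1%:R / N.+1%:R <= f y]) x : R).
  apply: measurable_sum => i; apply: measurable_funM => //.
  by apply: measurable_indic; exact: level_measurable.
have S0 x : 0 <= \sum_(i < N.+1)
    N.+1%:R^-1 * \1_([set y | i.+1%:R / N.+1%:R <= f y]) x.
  by apply: sumr_ge0 => i _; rewrite mulr_ge0// invr_ge0.
rewrite -(integral_cst_prob W).
rewrite -ge0_integralD//.
all: try (by move=> x _; rewrite lee_fin invr_ge0).
all: try (by move=> x _; rewrite lee_fin; apply: S0).
all: try (by exact/measurable_EFinP).
apply: ge0_le_integral => //.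
- by move=> x _; rewrite lee_fin; case/andP: (f01 x).
- exact/measurable_EFinP.
- by apply: emeasurable_funD => //; exact/measurable_EFinP.
move=> x _; rewrite /cst -EFinD lee_fin -mulr_sumr -{1}[_^-1]mulr1 -mulrDr.
rewrite -ler_pdivrMl ?invr_gt0// invrK.
have /andP[f0 f1] := f01 x.
have Nf : 0 <= N.+1%:R * f x <= N.+1%:R.
  by rewrite mulr_ge0//= -[leRHS]mulr1 ler_pM2l.
rewrite (le_trans (le_1Dcount Nf))// lerD2l; apply: ler_sum => i _.
rewrite indicE (_ : (x \in _) = (i.+1%:R <= N.+1%:R * f x))//.
by apply/idP/idP; rewrite inE/= ler_pdivrMr// mulrC.
Qed.

Let trunc_integral (h : T -> R) c := E (fun x => Num.min (h x) c).

(** As [E f] is the integral of the level function of [f], this is a one-dimensional inequality for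
    geometric means: lower Riemann sums for [f] and [g] are transported by [blocks_mass_transport],
    then the mesh tends to 0. *)
Lemma level_prekopa_leindler (f g h : T -> R) :
  measurable_fun setT f -> measurable_fun setT g -> measurable_fun setT h ->
  (forall x, 0 <= f x <= 1) -> (forall x, 0 <= g x <= 1) ->
  (forall x, 0 <= h x <= 1) ->
  (forall a b, 0 < a -> 0 < b ->
    fine (W [set x | a <= f x]) * fine (W [set x | b <= g x]) <=
    fine (W [set x | Num.sqrt (a * b) <= h x]) ^+ 2) ->
  E f * E g <= E h ^+ 2.
Proof.
move=> mf mg mh f01 g01 h01 fgh.
have mmin c : measurable_fun setT (fun x => Num.min (h x) c).
  by apply: measurable_minr.
have min01 c : 0 <= c -> forall x, 0 <= Num.min (h x) c <= 1.
  move=> c0 x; case/andP: (h01 x) => h0 h1.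
  by rewrite le_min h0 c0 ge_min h1.
have E_ge0 (u : T -> R) : (forall x, 0 <= u x <= 1) -> 0 <= E u.
  move=> u01; apply: fine_ge0; apply: integral_ge0 => x _.
  by rewrite lee_fin; case/andP: (u01 x).
have E_le1 (u : T -> R) : measurable_fun setT u -> (forall x, 0 <= u x <= 1) ->
    E u <= 1.
  move=> mu u01; rewrite -lee_fin fineK ?unit_integral_fin_num//.
  apply: (@le_trans _ _ (\int[W]_x (cst 1%:E) x)%E).
    apply: ge0_le_integral => //.
    - by move=> x _; rewrite lee_fin; case/andP: (u01 x).
    - exact/measurable_EFinP.
    - by move=> x _; rewrite lee_fin; case/andP: (u01 x).
  by rewrite integral_cst_prob.
(* Pointwise, [min h c' + (c - c') * 1_{h >= c} <= min h c]. *)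
have I_step c' c : 0 <= c' <= c ->
    trunc_integral h c' + (c - c') * level h c <= trunc_integral h c.
  move=> /andP[c'0 c'c]; have c0 := le_trans c'0 c'c.
  rewrite /trunc_integral -lee_fin EFinD !fineK//.
  all: try (by apply: unit_integral_fin_num => //; exact: min01).
  all: try (by apply: unit_integral_fin_num => //; exact: min01).
  have mL := level_measurable c mh.
  rewrite EFinM /level prob_fineK//.
  rewrite -[X in W X]setIT -integral_indic// -ge0_integralZl//.
  all: try (by apply/measurable_EFinP/measurable_indic).
  all: try (by move=> x _; rewrite lee_fin).
  all: try (by rewrite lee_fin subr_ge0).
  rewrite -ge0_integralD//.
  all: try (by move=> x _; rewrite lee_fin; case/andP: (h01 x) => h0 _; rewrite le_min h0).
  all: try (by exact/measurable_EFinP).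
  all: try (by move=> x _; rewrite -EFinM lee_fin mulr_ge0// subr_ge0).
  all: try (by apply: measurable_funeM; apply/measurable_EFinP/measurable_indic).
  apply: ge0_le_integral => //.
  - move=> x _; rewrite adde_ge0//.
      by rewrite lee_fin; case/andP: (h01 x) => h0 _; rewrite le_min h0.
    by rewrite -EFinM lee_fin mulr_ge0// subr_ge0.
  - apply: emeasurable_funD; first exact/measurable_EFinP.
    by apply: measurable_funeM; apply/measurable_EFinP/measurable_indic.
  - exact/measurable_EFinP.
  move=> x _; rewrite -EFinM -EFinD lee_fin indicE.
  have [|hx] := boolP (x \in [set y | c <= h y]).
    rewrite inE /= => ch; rewrite (min_r ch) (min_r (le_trans c'c ch)) mulr1.
    by rewrite addrC subrK.
  by rewrite mulr0 addr0 le_min2 ?lexx.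
(* If one of the integrals is at most the mesh, the product is small for that reason alone. *)
have lim (N : nat) : (E f - N.+1%:R^-1) * (E g - N.+1%:R^-1) <= E h ^+ 2 \/
    E f <= N.+1%:R^-1 \/ E g <= N.+1%:R^-1.
  have [?|fN] := leP (E f) N.+1%:R^-1; first by right; left.
  have [?|gN] := leP (E g) N.+1%:R^-1; first by right; right.
  left; set p := uniform_blocks (level f) N N.+1.
  set q := uniform_blocks (level g) N N.+1.
  have fp : E f - N.+1%:R^-1 <= blocks_mass p by rewrite lerBlDl integral_le_blocks.
  have gq : E g - N.+1%:R^-1 <= blocks_mass q by rewrite lerBlDl integral_le_blocks.
  have p0 : 0 < blocks_mass p by rewrite (lt_le_trans _ fp)// subr_gt0.
  have q0 : 0 < blocks_mass q by rewrite (lt_le_trans _ gq)// subr_gt0.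
  apply: (@le_trans _ _ (blocks_mass p * blocks_mass q)).
    by rewrite ler_pM// subr_ge0 ltW.
  (* With [r] the ratio of the masses, [sqrt r * blocks_mass p] is the geometric mean of the two
     masses. *)
  have r0 : 0 < blocks_mass q / blocks_mass p by rewrite divr_gt0.
  have level_blocks (u : T -> R) : measurable_fun setT u ->
      blocks_below (level u) (uniform_blocks (level u) N N.+1).
    move=> mu; apply: uniform_blocks_below => [a|a b ab].
      exact: fine_prob_ge0.
    exact: level_ni.
  have : Num.sqrt (blocks_mass q / blocks_mass p) * blocks_mass p <=
      trunc_integral h (Num.sqrt (blocks_length p * blocks_length q)).
    apply: (@blocks_mass_transport R (level f) (level g) (level h)
      (trunc_integral h)) => //.
    - by move=> u; exact: fine_prob_ge0.
    - by apply: E_ge0; exact: min01.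
    - exact: level_blocks.
    - exact: level_blocks.
    - by rewrite divfK// gt_eqF.
  (* Both lists have length 1, and truncating [h <= 1] at 1 changes nothing. *)
  rewrite !uniform_blocks_length divff ?pnatr_eq0// mulr1 sqrtr1.
  have -> : trunc_integral h 1 = E h.
    congr fine; apply: eq_integral => x _; rewrite min_l//.
    by case/andP: (h01 x).
  move=> h1; apply: le_trans (lerXn2r 2 _ _ h1).
  all: try (by rewrite nnegrE mulr_ge0 ?sqrtr_ge0// ltW).
  all: try (by rewrite nnegrE E_ge0).
  rewrite exprMn sqr_sqrtr; last exact: ltW.
  by rewrite expr2 mulrA divfK ?gt_eqF// mulrC.
apply/ler_addgt0Pr => e e0.
pose N := Num.truncn (2 / e).
have Ne : 2 * N.+1%:R^-1 < e.
  by rewrite ltr_pdivrMr// mulrC -ltr_pdivrMr// truncnS_gt.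
have N0 : 0 < N.+1%:R^-1 :> R by rewrite invr_gt0.
have f0 := E_ge0 _ f01; have g0 := E_ge0 _ g01; have f1 := E_le1 _ mf f01.
have g1 := E_le1 _ mg g01; have h2 := sqr_ge0 (E h).
move: (lim N) f0 g0 f1 g1 Ne N0 h2.
move: (E f) (E g) (E h ^+ 2) (N.+1%:R^-1) => a b c x [le|[le|le]] *.
- have : x * (a + b) <= x * 2 by rewrite ler_pM2l//; lra.
  by have := sqr_ge0 x; move: le; rewrite expr2 => *; lra.
- have : a * b <= x * 1 by rewrite ler_pM.
  by lra.
- have : a * b <= 1 * x by rewrite ler_pM.
  by lra.
Qed.

End prekopa_leindler.

(** * Self-convolution *)

Section coordinates.
Context {R : realType} {n : nat}.
Implicit Types (x y : 'rV[R]_n) (A B : set 'rV[R]_n).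

Lemma norm_coord_le x i : `|x ord0 i| <= `|x|.
Proof.
rewrite [leRHS]/Num.Def.normr/= mx_normrE; apply/bigmax_geP; right.
by exists (ord0, i).
Qed.

Lemma norm_rV_le x M : 0 <= M -> (forall i, `|x ord0 i| <= M) -> `|x| <= M.
Proof.
move=> M0 xM; rewrite [leLHS]/Num.Def.normr/= mx_normrE; apply/bigmax_leP; split => //.
by move=> [j i] _ /=; rewrite ord1.
Qed.

(** This is [A - x], written as the section at [x] of the preimage of [A] under addition. *)
Definition translate x A : set 'rV[R]_n := [set y | A (x + y)].

Definition midset A B : set 'rV[R]_n := [set 2^-1 *: (a + b) | a in A & b in B].

Lemma compact_translate x A : compact A -> compact (translate x A).
Proof.
move=> cA; have -> : translate x A = (fun a => a - x) @` A.
  apply/seteqP; split => [y Ay|_ [a Aa <-]].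
    by exists (x + y); rewrite //= addrC addKr.
  by rewrite /translate/= addrC subrK.
apply: continuous_compact => //; apply: continuous_subspaceT => y.
by apply: continuousB; [exact: id|exact: cst_continuous].
Qed.

Lemma compact_midset A B : compact A -> compact B -> compact (midset A B).
Proof.
move=> cA cB.
have -> : midset A B = (fun p : 'rV[R]_n * 'rV[R]_n => 2^-1 *: (p.1 + p.2)) @` (A `*` B).
  apply/seteqP; split => [_ [a Aa [b Bb <-]]|_ [[a b] [/= Aa Bb] <-]].
    by exists (a, b).
  by exists a => //; exists b.
apply: continuous_compact; last exact: compact_setX.
apply: continuous_subspaceT => p.
apply: (@continuous_comp _ _ _ (fun p : 'rV[R]_n * 'rV[R]_n => p.1 + p.2)
  ( *:%R 2^-1)); [exact: add_continuous|exact: scaler_continuous].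
Qed.

Lemma midset_translate x y A B :
  midset (translate x A) (translate y B) `<=`
  translate (2^-1 *: (x + y)) (midset A B).
Proof.
move=> _ [a Aa [b Bb <-]]; exists (x + a) => //; exists (y + b) => //.
by rewrite -scalerDr addrACA.
Qed.

Lemma open_norm_ballP A :
  (forall x, A x -> exists2 e, 0 < e & forall y, `|x - y| < e -> A y) -> open A.
Proof.
move=> h; rewrite openE => x /h[e e0 eA]; apply/nbhs_ballP; exists e => // y.
by rewrite mx_norm_ball /ball_; exact: eA.
Qed.

Lemma open_neighborhood A (e : R) : open [set y | exists2 z, A z & `|y - z| < e].
Proof.
apply: open_norm_ballP => y [z Az yz].
exists (e - `|y - z|); first by rewrite subr_gt0.
move=> w yw; exists z => //.
rewrite -(subrK y w) -addrA (le_lt_trans (ler_normD _ _))// distrC.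
by rewrite -ltrBrDr.
Qed.

End coordinates.

(** * Second moments and level sets of translates *)

Section moments.
Context {R : realType} {n : nat}.
Implicit Types (W : probability (Rn R n) R) (A B : set 'rV[R]_n).

(** Log-concavity at [t = 1/2], squared to avoid roots; in this form it passes to convolutions. *)
Definition mid_log_concave W := forall A B, compact A -> compact B ->
  fine (W A) * fine (W B) <= fine (W (midset A B)) ^+ 2.

(* Quantifying over the shift [b] encodes mean 0 and variance [v] without
   signed integrals. *)
Definition centered_variance W (v : R) := forall (i : 'I_n) (b : R),
  (\int[W]_x (((x : 'rV[R]_n) ord0 i + b) ^+ 2)%:E = (v + b ^+ 2)%:E)%E.

Lemma coord_shift_sqr_measurable (i : 'I_n) (b : R) :
  measurable_fun setT (fun x : Rn R n => ((x : 'rV[R]_n) ord0 i + b) ^+ 2).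
Proof.
apply: measurable_funX; apply: measurable_funD => //.
exact: coord_measurable_Rn.
Qed.

Lemma coord_level_measurable (i : 'I_n) (b : R) :
  measurable ([set x | b <= `|x ord0 i|] : set (Rn R n)).
Proof.
rewrite -[X in measurable X]setTI; apply: measurable_fun_le => //.
by apply: measurableT_comp => //; exact: coord_measurable_Rn.
Qed.

Lemma centered_variance_ge0 W v : (0 < n)%N -> centered_variance W v -> 0 <= v.
Proof.
move=> n0 /(_ (Ordinal n0) 0); rewrite expr0n/= addr0 => h.
by rewrite -lee_fin -h; apply: integral_ge0 => x _; rewrite lee_fin sqr_ge0.
Qed.

Lemma chebyshev_coord W v i b : centered_variance W v -> 0 < b ->
  fine (W [set x : Rn R n | b <= `|(x : 'rV[R]_n) ord0 i|]) <= v / b ^+ 2.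
Proof.
move=> Wv b0; rewrite ler_pdivlMr ?exprn_gt0// mulrC.
have := markov_ineq W (coord_shift_sqr_measurable i 0)
  (fun x => sqr_ge0 _) (sqr_ge0 b).
rewrite Wv expr0n/= addr0.
rewrite (_ : [set x | _] = [set x : Rn R n | b <= `|(x : 'rV[R]_n) ord0 i|]).
  by rewrite -(prob_fineK W (coord_level_measurable i b)) -EFinM lee_fin.
by apply/seteqP; split => x /=; rewrite addr0 -(real_normK (num_real (x ord0 i)))
  ler_sqr ?nnegrE// ltW.
Qed.

(** Upper semicontinuity: the open neighbourhoods of the compact set [A - x] decrease to it, so one
    of them has measure below [a], and it contains [A - x'] for all [x'] close to [x]. *)
Lemma level_translate_closed W A (a : R) : compact A ->
  closed [set x | a <= fine (W (translate x A))].
Proof.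
move=> cA; rewrite -[X in closed X]setCK; apply: open_closedC.
apply: open_norm_ballP => x /= /negP; rewrite -ltNge => xa.
pose U k : set 'rV[R]_n := [set y | exists2 z, translate x A z & `|y - z| < k.+1%:R^-1].
have mU k : measurable (U k : set (Rn R n)).
  by apply: open_measurable_Rn; exact: open_neighborhood.
have cT := @compact_translate _ _ x _ cA.
have mT := compact_measurable_Rn cT.
have clT : closed (translate x A).
  by apply: compact_closed => //; exact: norm_hausdorff.
have UT : \bigcap_k U k = translate x A.
  apply/seteqP; split => [y Uy|y Ay k _]; last first.
    by exists y => //; rewrite subrr normr0 invr_gt0.
  apply: clT => V /nbhs_ballP[e /= e0 eV].
  have [z Az yz] := Uy (Num.truncn e^-1) I.
  exists z; split => //; apply: eV; rewrite mx_norm_ball /ball_/=.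
  by rewrite (lt_trans yz)// invf_plt ?posrE// truncnS_gt.
have : (W \o (U : nat -> set (Rn R n))) k @[k --> \oo] -->
    (fine (W (translate x A)))%:E.
  rewrite prob_fineK// -UT; apply: nonincreasing_cvg_mu => //.
  - by rewrite (le_lt_trans (probability_le1 _ _)) ?ltry.
  - by rewrite UT.
  - move=> k l kl; apply/subsetPset => y [z Az yz]; exists z => //.
    by rewrite (lt_le_trans yz)// lef_pV2 ?posrE// ler_nat.
move=> /fine_cvgP[_ /cvgr_lt/(_ a xa)][N _ NU].
exists N.+1%:R^-1; rewrite ?invr_gt0// => x' xx'; apply/negP; rewrite -ltNge.
apply: le_lt_trans (NU N _) => //=.
apply: le_fine_prob => //; first by apply: compact_measurable_Rn; exact: compact_translate.
move=> y Ay; exists (x' - x + y) => //.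
  by rewrite /translate/= addrA [x + _]addrC subrK.
by rewrite opprD addrCA subrr addr0 opprB.
Qed.

(** This makes level sets admissible in [mid_log_concave]. Boundedness is Chebyshev's inequality: if
    a coordinate of [x] is large, [A - x] lies far out in that coordinate. *)
Lemma level_translate_compact W v A (a : R) : centered_variance W v -> 0 < a ->
  compact A -> compact [set x | a <= fine (W (translate x A))].
Proof.
move=> Wv a0 cA; apply: bounded_closed_compact; last exact: level_translate_closed.
have [M0 [_ AM0]] := compact_bounded cA.
pose M := M0 + 1.
have AM z : A z -> `|z| <= M by move=> Az; apply: AM0 Az; rewrite ltrDl.
exists (`|M| + (1 + `|v| / a)); split; first exact: num_real.
(* Since [b >= 1] and [a * b > |v|], one gets [v / b ^ 2 < a]. *)
move=> K; set b := 1 + `|v| / a => MbK x /= xa.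
have b1 : 1 <= b by rewrite /b lerDl divr_ge0// ltW.
have b0 : 0 < b by rewrite (lt_le_trans _ b1).
have K0 : 0 <= K by rewrite (le_trans _ (ltW MbK))// addr_ge0// ltW.
apply: norm_rV_le => // i; apply: le_trans (ltW MbK).
rewrite leNgt; apply/negP => xi.
have : a <= v / b ^+ 2.
  apply: (le_trans xa); apply: le_trans (@chebyshev_coord _ _ i _ Wv b0).
  apply: le_fine_prob.
  - by apply: compact_measurable_Rn; exact: compact_translate.
  - exact: coord_level_measurable.
  move=> y Ay /=; have := norm_coord_le (x + y) i.
  move=> /le_trans/(_ (AM _ Ay)); rewrite mxE => xyM.
  have : `|x ord0 i| <= `|x ord0 i + y ord0 i| + `|y ord0 i|.
    by rewrite -[in X in X <= _](addrK (y ord0 i) (x ord0 i)) ler_normB.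
  by have := ler_norm M; lra.
rewrite leNgt => /negP; apply; rewrite ltr_pdivrMr ?exprn_gt0//.
rewrite (le_lt_trans (ler_norm v))//.
have : `|v| < a * b by rewrite mulrDr mulr1 mulrC divfK ?gt_eqF// ltrDr.
move/lt_le_trans; apply; rewrite ler_pM2l// expr2 -[leLHS]mulr1 ler_pM2l//.
Qed.

End moments.

Section self_convolution.
Context {R : realType} {n : nat}.
Implicit Types (W : probability (Rn R n) R) (A B : set 'rV[R]_n).

Definition addRn (p : Rn R n * Rn R n) : Rn R n := (p.1 : 'rV[R]_n) + p.2.

HB.instance Definition _ := isMeasurableFun.Build _ _ _ _ addRn addRn_measurable.

Definition self_conv W : probability (Rn R n) R := distribution (W \x W)%E addRn.

Let addRn_preimage_measurable A : measurable (A : set (Rn R n)) ->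
  measurable (addRn @^-1` A).
Proof.
by move=> mA; rewrite -[X in measurable X]setTI; exact: addRn_measurable.
Qed.

Let xsection_addRn A x : xsection (addRn @^-1` A) x = translate x A.
Proof. by rewrite xsectionE. Qed.

Lemma translate_prob_measurable W A : measurable (A : set (Rn R n)) ->
  measurable_fun setT (fun x : Rn R n => fine (W (translate x A))).
Proof.
move=> mA; apply: (measurableT_comp (fine_measurable _)) => //.
have := @measurable_fun_xsection _ _ _ _ R W _ (addRn_preimage_measurable mA).
by apply: eq_measurable_fun => x _ /=; rewrite xsection_addRn.
Qed.

Lemma translate_measurable A (x : 'rV[R]_n) : measurable (A : set (Rn R n)) ->
  measurable (translate x A : set (Rn R n)).
Proof.
by move=> mA; rewrite -xsection_addRn; apply: measurable_xsection;
  exact: addRn_preimage_measurable.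
Qed.

Lemma self_convE W A : measurable (A : set (Rn R n)) ->
  (self_conv W A = \int[W]_x (fine (W (translate x A)))%:E)%E.
Proof.
move=> mA; rewrite /self_conv /distribution /pushforward/=.
rewrite /product_measure1; apply: eq_integral => x _ /=.
by rewrite xsection_addRn prob_fineK//; exact: translate_measurable.
Qed.

(** The convolution of [A] is the integral of [x |-> W (A - x)]. Log-concavity of [W] enters twice:
    on translates, to put midpoints of level sets into the level set at [sqrt (a * b)], and on the
    compact level sets themselves; then [level_prekopa_leindler] applies. *)
Lemma self_conv_mid_log_concave W v : centered_variance W v ->
  mid_log_concave W -> mid_log_concave (self_conv W).
Proof.
move=> Wv Wlc A B cA cB.
have mA := compact_measurable_Rn cA; have mB := compact_measurable_Rn cB.
have cM := compact_midset cA cB; have mM := compact_measurable_Rn cM.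
have f01 (C : set 'rV[R]_n) (mC : measurable (C : set (Rn R n))) (x : Rn R n) :
    0 <= fine (W (translate x C)) <= 1.
  rewrite fine_prob_ge0/=; apply: fine_prob_le1; exact: translate_measurable.
rewrite !self_convE//; apply: level_prekopa_leindler;
  try exact: translate_prob_measurable; try exact: f01.
move=> a b a0 b0.
have cLA := level_translate_compact Wv a0 cA.
have cLB := level_translate_compact Wv b0 cB.
apply: (le_trans (Wlc _ _ cLA cLB)).
rewrite lerXn2r ?nnegrE ?fine_prob_ge0//; apply: le_fine_prob.
- by apply: compact_measurable_Rn; exact: compact_midset.
- rewrite -[X in measurable X]setTI; apply: measurable_fun_le => //.
  exact: translate_prob_measurable.
move=> _ [x /= xa [y /= yb <-]].
have cxA := @compact_translate _ _ x _ cA; have cyB := @compact_translate _ _ y _ cB.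
rewrite -[leRHS]ger0_norm ?fine_prob_ge0// -sqrtr_sqr ler_wsqrtr//.
apply: le_trans (lerXn2r 2 _ _ (le_fine_prob W _ _ (@midset_translate _ _ x y A B))).
- apply: le_trans (Wlc _ _ cxA cyB).
  by rewrite ler_pM// ltW.
- by rewrite nnegrE fine_prob_ge0.
- by rewrite nnegrE fine_prob_ge0.
- by apply: compact_measurable_Rn; exact: compact_midset.
- by apply: compact_measurable_Rn; exact: compact_translate.
Qed.

(** Integrating one summand first, with the other one absorbed into the shift, gives
    [v + (x i + b) ^ 2]; the second integration adds another [v]. *)
Lemma self_conv_centered_variance W v : (0 < n)%N -> centered_variance W v ->
  centered_variance (self_conv W) (v *+ 2).
Proof.
move=> n0 Wv i b; have v0 := centered_variance_ge0 n0 Wv.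
rewrite /self_conv /distribution.
rewrite ge0_integral_pushforward//.
all: try exact: addRn_measurable.
all: try (by apply/measurable_EFinP; exact: coord_shift_sqr_measurable).
all: try (by move=> x _; rewrite lee_fin sqr_ge0).
have mc := coord_shift_sqr_measurable (R := R) i b.
rewrite preimage_setT fubini_tonelli1//.
all: try (by apply: measurableT_comp; [exact/measurable_EFinP|exact: addRn_measurable]).
all: try (by move=> x /=; rewrite lee_fin sqr_ge0).
rewrite /fubini_F.
rewrite (eq_integral (fun x : Rn R n =>
    (v%:E + (((x : 'rV[R]_n) ord0 i + b) ^+ 2)%:E)%E)); last first.
  move=> x _; rewrite -EFinD -(Wv i); apply: eq_integral => y _ /=.
  by congr (_ ^+ 2)%:E; rewrite /addRn mxE/=; ring.
rewrite ge0_integralD//.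
all: try (by move=> x _; rewrite lee_fin sqr_ge0).
all: try exact/measurable_EFinP.
by rewrite (integral_cst_prob W) Wv -EFinD mulr2n addrA.
Qed.

Lemma halfspace_measurable (u : 'rV[R]_n) b :
  measurable ([set x | b <= dotRn x u] : set (Rn R n)).
Proof.
rewrite -[X in measurable X]setTI; apply: measurable_fun_le => //.
by apply: continuous_measurable_Rn; exact: dotRn_continuous.
Qed.

Lemma dotRnDl (x y u : 'rV[R]_n) : dotRn (x + y) u = dotRn x u + dotRn y u.
Proof. by rewrite -big_split; apply: eq_bigr => i _; rewrite mxE mulrDl. Qed.

Lemma dotRnZl a (x u : 'rV[R]_n) : dotRn (a *: x) u = a * dotRn x u.
Proof. by rewrite mulr_sumr; apply: eq_bigr => i _; rewrite mxE mulrA. Qed.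

(** If both summands lie in a halfspace, their sum lies in the doubled halfspace. *)
Lemma self_conv_halfspace W (u : 'rV[R]_n) b :
  fine (W [set x : Rn R n | b <= dotRn x u]) ^+ 2 <=
  fine (self_conv W [set x : Rn R n | b *+ 2 <= dotRn x u]).
Proof.
have mH := halfspace_measurable u b; have mH2 := halfspace_measurable u (b *+ 2).
rewrite -lee_fin (prob_fineK (self_conv W) mH2) expr2 EFinM.
rewrite (prob_fineK W mH) -product_measure1E//.
apply: le_measure; rewrite ?inE.
- exact: measurableX.
- exact: addRn_preimage_measurable.
- by move=> [x y] [/= xb yb]; rewrite /addRn/= dotRnDl mulr2n lerD.
Qed.

(** The law of a sum of [2 ^ m] independent copies, reached by doubling. *)
Definition iter_conv m W := iter m self_conv W.

Lemma iter_conv_props W m : (0 < n)%N ->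
  centered_variance W 1 -> mid_log_concave W ->
  centered_variance (iter_conv m W) (2 ^ m)%:R /\
  mid_log_concave (iter_conv m W).
Proof.
move=> n0 Wv Wlc; elim: m => [|m [ihv ihlc]] //=; split.
  by rewrite expnSr natrM mulr_natr; exact: self_conv_centered_variance.
exact: self_conv_mid_log_concave ihlc.
Qed.

Lemma iter_conv_halfspace W m (u : 'rV[R]_n) b :
  fine (W [set x : Rn R n | b <= dotRn x u]) ^+ (2 ^ m) <=
  fine (iter_conv m W [set x : Rn R n | (2 ^ m)%:R * b <= dotRn x u]).
Proof.
elim: m => [|m ih] /=; first by rewrite expr1 mul1r.
apply: le_trans (_ : _ <= fine (iter_conv m W
  [set x : Rn R n | (2 ^ m)%:R * b <= dotRn x u]) ^+ 2) _.
  by rewrite expnSr exprM lerXn2r ?nnegrE ?exprn_ge0 ?fine_prob_ge0.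
have := self_conv_halfspace (iter_conv m W) u ((2 ^ m)%:R * b).
by rewrite -mulrnAl -[_ *+ 2]mulr_natr -natrM -expnSr.
Qed.

End self_convolution.

(** * Midpoint and variance form of the hypotheses on a measure *)

Lemma log_concave_mid (R : realType) n (mu : probability (Rn R n) R) :
  log_concave mu -> mid_log_concave mu.
Proof.
move=> [lc _] A B cA cB.
have h2 : 1 - 2^-1 = 2^-1 :> R by field.
have := lc A B 2^-1 cA cB.
rewrite invr_gt0 invf_lt1// ltr1n ltr0n h2 => /(_ isT).
rewrite -powRM ?fine_prob_ge0// powR12_sqrt ?mulr_ge0 ?fine_prob_ge0//.
have -> : mink_comb 2^-1 A B = midset A B.
  rewrite /mink_comb h2; apply/seteqP; split => _ [a Aa [b Bb <-]];
    by exists a => //; exists b => //; rewrite scalerDr.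
move=> /(lerXn2r 2); rewrite sqr_sqrtr ?mulr_ge0 ?fine_prob_ge0//; apply.
  by rewrite nnegrE sqrtr_ge0.
by rewrite nnegrE fine_prob_ge0.
Qed.

Lemma isotropic_centered_variance (R : realType) n (mu : probability (Rn R n) R) :
  isotropic mu -> centered_variance mu 1.
Proof.
move=> [m1 m2] i b; have [i1 e1] := m1 i; have [i2] := m2 i i; rewrite eqxx => e2.
have c2 : mu.-integrable setT (cst (b ^+ 2)%:E : Rn R n -> \bar R).
  by apply/finite_measure_integrable_cst.
rewrite (eq_integral (fun x : Rn R n => (((x : 'rV[R]_n) ord0 i *
    (x : 'rV[R]_n) ord0 i)%:E + ((2 * b)%:E * ((x : 'rV[R]_n) ord0 i)%:E +
    cst (b ^+ 2)%:E x))%E)); last first.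
  by move=> x _; rewrite -EFinM -!EFinD; congr EFin; rewrite /=; ring.
have i3 : mu.-integrable setT
    (fun x : Rn R n => ((2 * b)%:E * ((x : 'rV[R]_n) ord0 i)%:E)%E).
  exact: integrableZl.
rewrite integralD//; last exact: integrableD.
by rewrite integralD// integralZl// e1 e2 (integral_cst_prob mu) mule0 add0e.
Qed.

(** * Boxes and lattices *)

Section counting.
Context {R : realType}.

(** Counted from the least element of [P], all indices fall into a window of [J] integers. *)
Lemma sum_window_le K J (P : pred 'I_K) :
  (forall k k', P k -> P k' -> (k' < k + J)%N) ->
  \sum_(k < K) (P k)%:R <= J%:R :> R.
Proof.
move=> PJ; rewrite -natr_sum ler_nat -big_mkcond/= sum1_card.
have [k0 Pk0|P0] := pickP P; last by rewrite eq_card0.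
have [k Pk kmin] := @arg_minnP _ k0 P val Pk0.
have : (0 < J)%N by have := PJ _ _ Pk0 Pk0; rewrite -[X in (X < _)%N]addn0 ltn_add2l.
case: J PJ => // J PJ _.
pose f (j : 'I_K) : 'I_J.+1 := inord (j - k).
have finj : {in P &, injective f}.
  move=> i j Pi Pj /(congr1 val); rewrite /f /= !inordK; first last.
  - by rewrite ltn_subLR ?kmin//; exact: PJ.
  - by rewrite ltn_subLR ?kmin//; exact: PJ.
  move=> ij; apply: val_inj => /=.
  by rewrite -(subnK (kmin _ Pi)) ij subnK// kmin.
by rewrite -(card_in_image finj) (leq_trans (max_card _))// card_ord.
Qed.

Lemma sum_half_pow_lt M : \sum_(k < M) 2^-1 ^+ (M - k) <= 1 :> R.
Proof.
elim: M => [|M ih]; first by rewrite big_ord0.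
rewrite big_ord_recr/= subSnn expr1.
rewrite (eq_bigr (fun k : 'I_M => 2^-1 * 2^-1 ^+ (M - k))); last first.
  by move=> k _; rewrite -exprS subSn// ltnW.
by rewrite -mulr_sumr; lra.
Qed.

Lemma sum_half_pow M : \sum_(k < M) 2^-1 ^+ k <= 2 :> R.
Proof.
suff : \sum_(k < M) 2^-1 ^+ k + 2 * 2^-1 ^+ M = 2 :> R.
  by have : 0 <= 2^-1 ^+ M :> R by [rewrite exprn_ge0]; lra.
elim: M => [|M ih]; first by rewrite big_ord0 expr0; lra.
by rewrite big_ord_recr/= -[RHS]ih exprS; field.
Qed.

(* In truncated arithmetic [(M - k) + (k - M)] is the distance of [k] to [M]. *)
Lemma sum_half_pow_dist M :
  \sum_(k < M + M) 2^-1 ^+ ((M - k) + (k - M)) <= 3 :> R.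
Proof.
rewrite big_split_ord/=.
rewrite (eq_bigr (fun k : 'I_M => 2^-1 ^+ (M - k))); last first.
  by move=> k _; rewrite (eqP (ltnW (ltn_ord k) : k - M == 0)%N) addn0.
rewrite [X in _ + X](eq_bigr (fun k : 'I_M => 2^-1 ^+ k)); last first.
  by move=> k _; rewrite addKn subnDA subnn sub0n.
by have := sum_half_pow_lt M; have := sum_half_pow M; lra.
Qed.

End counting.

Section boxes.
Context {R : realType} {n : nat}.
Implicit Types (W : probability (Rn R n) R) (x y p : 'rV[R]_n).

Definition box (r : R) x : set 'rV[R]_n :=
  [set y | forall i, `|y ord0 i - x ord0 i| <= r].

Lemma compact_box r x : compact (box r x).
Proof.
have -> : box r x = [set y : 'rV[R]_n | forall i,
    `[x ord0 i - r, x ord0 i + r]%classic (y ord0 i)].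
  by apply/seteqP; split => y /= h i; have := h i; rewrite in_itv/= ler_distl.
apply: (@rV_compact _ _ (fun i => `[x ord0 i - r, x ord0 i + r]%classic)) => i.
exact: segment_compact.
Qed.

Lemma box_measurable r x : measurable (box r x : set (Rn R n)).
Proof. by apply: compact_measurable_Rn; exact: compact_box. Qed.

Lemma box_translate r x : translate (- x) (box r 0) = box r x.
Proof.
apply/seteqP; split => y /= h i; have := h i;
  by rewrite !mxE subr0 addrC.
Qed.

Lemma midset_box r x y : midset (box r x) (box r y) `<=` box r (2^-1 *: (x + y)).
Proof.
move=> _ [a xa [b yb <-]] i; have := xa i; have := yb i.
by rewrite !mxE !ler_distl => /andP[? ?] /andP[? ?]; apply/andP; split; lra.
Qed.

Lemma box_mid_log_concave W r x y : mid_log_concave W ->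
  fine (W (box r x)) * fine (W (box r y)) <=
  fine (W (box r (2^-1 *: (x + y)))) ^+ 2.
Proof.
move=> Wlc; apply: (le_trans (Wlc _ _ (compact_box (x := x)) (compact_box (x := y)))).
rewrite lerXn2r ?nnegrE ?fine_prob_ge0//; apply: le_fine_prob.
- by apply: compact_measurable_Rn; apply: compact_midset; exact: compact_box.
- exact: box_measurable.
- exact: midset_box.
Qed.

(** A box around [x] is the box around 0 translated by [- x], so this is a reflected level set of
    translates. *)
Lemma compact_level_box W v r a : centered_variance W v -> 0 < a ->
  compact [set x | a <= fine (W (box r x))].
Proof.
move=> Wv a0.
have cB : compact (box r (0 : 'rV[R]_n)) by exact: compact_box.
have := level_translate_compact Wv a0 cB.
set L := [set x | _] => cL.
have -> : [set x | a <= fine (W (box r x))] = -%R @` L.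
  apply/seteqP; split => [x /= ax|_ [x ax <-]].
    by exists (- x); rewrite /L/= ?opprK// box_translate.
  by rewrite /= -box_translate opprK.
apply: continuous_compact => //; apply: continuous_subspaceT => x.
exact: opp_continuous.
Qed.

(** By distributivity, the number of product sets containing [y] is a product of one-coordinate
    counts, each at most [J]. *)
Lemma sum_prob_product_le W K (P : 'I_n -> 'I_K -> set R) (J : nat) :
  (forall i k, measurable (P i k)) ->
  (forall i u, \sum_(k < K) (u \in P i k)%:R <= J%:R :> R) ->
  \sum_(z : {ffun 'I_n -> 'I_K})
     fine (W [set y : Rn R n | forall i, P i (z i) ((y : 'rV[R]_n) ord0 i)])
  <= J%:R ^+ n.
Proof.
move=> mP PJ; apply: sum_fine_prob_le.
  move=> z; apply: (@measurable_forall _ _ _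
    (fun i => (fun y : Rn R n => (y : 'rV[R]_n) ord0 i) @^-1` P i (z i))) => i.
  by rewrite -[X in measurable X]setTI; exact: coord_measurable_Rn.
move=> y.
apply: (@le_trans _ _ (\sum_(z : {ffun 'I_n -> 'I_K}) \prod_i
    ((y : 'rV[R]_n) ord0 i \in P i (z i))%:R)).
  apply: ler_sum => z _; have [|_] := boolP (y \in _); last exact: prodr_ge0.
  rewrite inE/= => yz; rewrite big1// => i _.
  by rewrite (_ : (_ \in _)) //; apply/mem_set; exact: yz.
rewrite -(bigA_distr_bigA (fun i k => ((y : 'rV[R]_n) ord0 i \in P i k)%:R)).
rewrite -[n in leRHS]card_ord -prodr_const.
by apply: ler_prod => i _; rewrite PJ andbT; exact: sumr_ge0.
Qed.

(** In each coordinate, the grid points of spacing [t] within [r] of a given number fall into a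
    window of fewer than [J + 1] indices. *)
Lemma sum_box_le W K (b : 'I_n -> R) (t r : R) (J : nat) : 0 < t ->
  2 * r < J%:R * t ->
  \sum_(z : {ffun 'I_n -> 'I_K}) fine (W (box r (\row_i (b i + t * (z i)%:R))))
  <= J%:R ^+ n.
Proof.
move=> t0 rJ.
pose P i (k : 'I_K) : set R := [set u | `|u - (b i + t * k%:R)| <= r].
rewrite (eq_bigr (fun z : {ffun 'I_n -> 'I_K} => fine (W [set y : Rn R n |
    forall i, P i (z i) ((y : 'rV[R]_n) ord0 i)]))); last first.
  move=> z _; congr (fine (W _)).
  by apply/seteqP; split => y /= h i; have := h i; rewrite /P/= mxE.
apply: sum_prob_product_le => [i k|i u].
  rewrite (_ : P i k = `[b i + t * k%:R - r, b i + t * k%:R + r]%classic)//.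
  by apply/seteqP; split => w; rewrite /P/= in_itv/= ler_distl.
apply: sum_window_le => k k' /set_mem + /set_mem; rewrite /P /= !ler_distl.
move=> /andP[k1 k2] /andP[k3 k4].
have : t * k'%:R < t * (k + J)%:R by rewrite natrD; lra.
by rewrite ltr_pM2l// ltr_nat.
Qed.

End boxes.

(** * Lattice cells and a box of large measure *)

Section lattice.
Context {R : realType} {n : nat}.
Implicit Types (W : probability (Rn R n) R) (x y p : 'rV[R]_n).

(** The index set is finite and the shift by [M] centres it: coordinates run from [- s * M] to
    [s * (M - 1)]. *)
Definition lattice (s : R) M (z : {ffun 'I_n -> 'I_(M + M)}) : 'rV[R]_n :=
  \row_i (s * ((z i)%:R - M%:R)).

(** Half-open sides make the cells disjoint. *)
Definition cell (s : R) M (z : {ffun 'I_n -> 'I_(M + M)}) : set 'rV[R]_n :=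
  [set y | forall i, lattice s z ord0 i <= y ord0 i < lattice s z ord0 i + s].

Definition outside (a : R) : set 'rV[R]_n := [set y | exists i, a <= `|y ord0 i|].

Let cell_side (s : R) M (k : 'I_(M + M)) : set R :=
  `[s * (k%:R - M%:R), s * (k%:R - M%:R) + s[%classic.

Let cellE s M (z : {ffun 'I_n -> 'I_(M + M)}) :
  cell s z = [set y | forall i, cell_side s (z i) (y ord0 i)].
Proof.
by apply/seteqP; split => y /= h i; have := h i; rewrite /cell_side /= in_itv/= !mxE.
Qed.

Lemma cell_measurable s M (z : {ffun 'I_n -> 'I_(M + M)}) :
  measurable (cell s z : set (Rn R n)).
Proof.
rewrite cellE; apply: (@measurable_forall _ (Rn R n) _
  (fun i => (fun y : Rn R n => (y : 'rV[R]_n) ord0 i) @^-1` cell_side s (z i))) => i.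
by rewrite -[X in measurable X]setTI; apply: coord_measurable_Rn => //;
  exact: measurable_itv.
Qed.

Lemma outside_measurable a : measurable (outside a : set (Rn R n)).
Proof.
rewrite -[X in measurable X]setCK; apply: measurableC.
have -> : ~` outside a = [set y | forall i, (~` [set x | a <= `|x ord0 i|]) y].
  by apply/seteqP; split => [y yo i yi|y h [i]]; [apply: yo; exists i|exact: h].
apply: (@measurable_forall _ (Rn R n) _
  (fun i => ~` [set x : 'rV[R]_n | a <= `|x ord0 i|])) => i.
by apply: measurableC; exact: coord_level_measurable.
Qed.

Lemma cell_sub_box s M (z : {ffun 'I_n -> 'I_(M + M)}) :
  cell s z `<=` box s (lattice s z).
Proof. by move=> y h i; have /andP[h1 h2] := h i; rewrite ler_distl; lra. Qed.

Lemma cell_cover s M y : 0 < s -> ~ outside (s * M%:R) y ->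
  exists z : {ffun 'I_n -> 'I_(M + M)}, cell s z y.
Proof.
move=> s0 yo.
have yM i : `|y ord0 i| < s * M%:R.
  by rewrite ltNge; apply/negP => h; apply: yo; exists i.
have k_ i : {k : 'I_(M + M) | s * (k%:R - M%:R) <= y ord0 i <
    s * (k%:R - M%:R) + s}.
  have := yM i; rewrite ltr_norml => /andP[y1 y2].
  pose u := y ord0 i / s + M%:R.
  have us : u * s = y ord0 i + M%:R * s by rewrite mulrDl divfK ?gt_eqF.
  have u0 : 0 <= u by rewrite -lerBlDr sub0r ler_pdivlMr// mulNr mulrC ltW.
  have uM : u < (M + M)%:R by rewrite natrD ltrD2r ltr_pdivrMr// mulrC.
  have /andP[t1 t2] := truncn_itv u0.
  have tM : (Num.truncn u < M + M)%N by rewrite -(ltr_nat R) (le_lt_trans t1).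
  exists (Ordinal tM) => /=.
  have t1' : (Num.truncn u)%:R * s <= u * s by rewrite ler_pM2r.
  have t2' : u * s < ((Num.truncn u)%:R + 1) * s by rewrite ltr_pM2r// natr1.
  by move: t1' t2'; rewrite us => t1' t2'; apply/andP; split; lra.
exists [ffun i => sval (k_ i)] => i; rewrite !mxE ffunE; exact: (svalP (k_ i)).
Qed.

Lemma sum_cell_le W s M : 0 < s ->
  \sum_(z : {ffun 'I_n -> 'I_(M + M)}) fine (W (cell s z)) <= 1.
Proof.
move=> s0; under eq_bigr do rewrite cellE.
rewrite -[leRHS](expr1n _ n) -[in leRHS](mulr1n 1).
apply: (@sum_prob_product_le _ _ W _ (fun=> @cell_side s M) 1%N) => [i k|i u].
  exact: measurable_itv.
apply: sum_window_le => k k' /set_mem + /set_mem.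
rewrite /cell_side/= !in_itv/= => /andP[k1 k2] /andP[k3 k4].
have : s * k'%:R < s * (k + 1)%:R by rewrite natrD; lra.
by rewrite ltr_pM2l// ltr_nat.
Qed.

Lemma outside_chebyshev W v a : centered_variance W v -> 0 < a ->
  fine (W (outside a)) <= n%:R * (v / a ^+ 2).
Proof.
move=> Wv a0; apply: (@le_trans _ _ (\sum_(i < n)
    fine (W [set y : Rn R n | a <= `|(y : 'rV[R]_n) ord0 i|]))).
  apply: fine_prob_sum_cover; first exact: outside_measurable.
    by move=> i; exact: coord_level_measurable.
  by move=> y [i yi]; exists i.
apply: (@le_trans _ _ (\sum_(i < n) v / a ^+ 2)).
  by apply: ler_sum => i _; exact: chebyshev_coord.
by rewrite sumr_const card_ord mulr_natl.
Qed.

Lemma outside_le W s M : centered_variance W (s ^+ 2) -> 0 < s -> (0 < M)%N ->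
  fine (W (outside (s * M%:R))) <= n%:R / M%:R ^+ 2.
Proof.
move=> Wv s0 M0; have sM0 : 0 < s * M%:R by rewrite mulr_gt0// ltr0n.
apply: (le_trans (outside_chebyshev Wv sM0)).
by rewrite exprMn invfM [s ^+ 2 * _]mulrA divff ?mul1r// expf_neq0// gt_eqF.
Qed.

(** By the second moment, [|y| ^ 2 < 2 * n * s ^ 2] with probability at least [1/2]. Such points lie
    outside the lattice cube, with probability at most [1/4], or in at most [24 ^ n] cells. If all
    boxes had measure below [100^-1 ^ n], these cells would carry less than [1/4]. *)
Lemma exists_heavy_box W s M : centered_variance W (s ^+ 2) -> 0 < s ->
  (0 < n)%N -> (0 < M)%N -> n%:R / M%:R ^+ 2 <= 4^-1 :> R ->
  exists z : {ffun 'I_n -> 'I_(M + M)},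
    100^-1 ^+ n <= fine (W (box s (lattice s z))).
Proof.
move=> Wv s0 n0 M0 nM.
have s20 : 0 < s ^+ 2 by rewrite exprn_gt0.
have n0' : 0 < n%:R :> R by rewrite ltr0n.
pose q (y : Rn R n) := \sum_(i < n) ((y : 'rV[R]_n) ord0 i + 0) ^+ 2.
have mq : measurable_fun setT q.
  by apply: measurable_sum => i; exact: coord_shift_sqr_measurable.
have q0 y : 0 <= q y by apply: sumr_ge0 => i _; rewrite sqr_ge0.
have Eq : (\int[W]_y (q y)%:E = (n%:R * s ^+ 2)%:E)%E.
  under eq_integral do rewrite -sumEFin.
  rewrite ge0_integral_sum//.
  - under eq_bigr do rewrite Wv expr0n/= addr0.
    by rewrite sumEFin sumr_const card_ord mulr_natl.
  - by move=> i; apply/measurable_EFinP; exact: coord_shift_sqr_measurable.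
  - by move=> i y _; rewrite lee_fin sqr_ge0.
pose t := 2 * (n%:R * s ^+ 2).
have t0 : 0 < t by rewrite !mulr_gt0.
pose S : set (Rn R n) := [set y | t <= q y].
have mS : measurable S.
  by rewrite -[X in measurable X]setTI; exact: measurable_fun_le.
have WS : fine (W S) <= 2^-1.
  have := markov_ineq W mq q0 (ltW t0); rewrite Eq -(prob_fineK W mS) -EFinM.
  by rewrite lee_fin /t => h; rewrite -(ler_pM2l t0) /t; lra.
have mO := outside_measurable (s * M%:R).
have WO := outside_le Wv s0 M0.
pose dist (k : 'I_(M + M)) := ((M - k) + (k - M))%N.
pose Q (z : {ffun 'I_n -> 'I_(M + M)}) := (\sum_i dist (z i) <= 3 * n)%N.
have cover : 4^-1 <= \sum_(z | Q z) fine (W (cell s z)).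
  (* The two extra indices stand for the set of large second moment and for the outside of the
     cube. *)
  pose B (z : option (option {ffun 'I_n -> 'I_(M + M)})) : set (Rn R n) :=
    match z with None => S | Some None => outside (s * M%:R)
    | Some (Some z) => cell s z end.
  pose Q' (z : option (option {ffun 'I_n -> 'I_(M + M)})) :=
    if z is Some (Some z) then Q z else true.
  have mB z : measurable (B z).
    by case: z => [[z|]|] => //; exact: cell_measurable.
  have := @fine_prob_sum_cover _ _ _ W _ Q' setT B measurableT mB.
  rewrite probability_setT /=.
  rewrite (bigD1 None)//= (bigD1 (Some None))//=.
  have -> : \sum_(z | (Q' z && (z != None)) && (z != Some None)) fine (W (B z)) =
      \sum_(z | Q z) fine (W (cell s z)).
    rewrite (reindex_omap (fun z => Some (Some z)) (fun z => if z is Some z then z else None)).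
      by apply: eq_bigl => z /=; rewrite eqxx !andbT.
    by case=> [[z|]|].
  move=> h; suff : 1 <= fine (W S) + (fine (W (outside (s * M%:R))) +
      \sum_(z | Q z) fine (W (cell s z))) by lra.
  apply: h => y _.
  have [Sy|Sy] := pselect (S y); first by exists None.
  have [Oy|Oy] := pselect (outside (s * M%:R) y); first by exists (Some None).
  have [z zy] := cell_cover s0 Oy; exists (Some (Some z)) => //=.
  rewrite /Q -(ler_nat R) natr_sum.
  have qt : q y < t by rewrite ltNge; apply/negP.
  (* The index is within 1 of [w = y i / s], and [|w| <= (w ^ 2 + 1) / 2]. Summed up, this gives at
     most [n + 3 * n / 2], below the threshold [3 * n] of [Q]. *)
  have di i : (dist (z i))%:R <= (s ^+ 2)^-1 * ((y ord0 i + 0) ^+ 2 * 2^-1) + 3 / 2.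
    have /andP[] := zy i; rewrite mxE addr0; set u := y ord0 i => u1 u2.
    pose w := u / s; have uw : u = w * s by rewrite /w divfK// gt_eqF.
    have -> : (s ^+ 2)^-1 * (u ^+ 2 * 2^-1) = w ^+ 2 / 2.
      by rewrite uw; field; rewrite gt_eqF.
    move: u1 u2; rewrite uw => u1 u2.
    have v1 : (z i)%:R - M%:R <= w by rewrite -(ler_pM2r s0); lra.
    have v2 : w < (z i)%:R - M%:R + 1 by rewrite -(ltr_pM2r s0); lra.
    have w2 : 0 <= (w - 1) ^+ 2 by rewrite sqr_ge0.
    have w2' : 0 <= (w + 1) ^+ 2 by rewrite sqr_ge0.
    rewrite /dist natrD; have [zM|zM] := leqP (z i) M.
      by rewrite (natrB _ zM) (eqP (zM : _ == 0)%N); lra.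
    rewrite (natrB _ (ltnW zM)) (eqP (ltnW zM : _ == 0)%N); lra.
  apply: (le_trans (ler_sum _ (fun i _ => di i))).
  rewrite big_split/= -mulr_sumr -mulr_suml sumr_const card_ord -mulr_natl natrM.
  have : (s ^+ 2)^-1 * (q y / 2) <= n%:R.
    rewrite -(ler_pM2l s20) mulrA divff ?gt_eqF// mul1r.
    by move: qt; rewrite /t; lra.
  by rewrite /q; lra.
(* On [Q] one has [1 <= 8 ^ n * 2 ^ (- sum of dist)]; summed over all [z], the weight factors into
   one-dimensional sums, each at most 3. *)
have card_Q : \sum_(z | Q z) 1 <= 24 ^+ n :> R.
  apply: (@le_trans _ _ (\sum_(z : {ffun 'I_n -> 'I_(M + M)})
      8 ^+ n * \prod_i 2^-1 ^+ dist (z i))).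
    rewrite big_mkcond/=; apply: ler_sum => z _.
    have z0 : 0 <= \prod_i 2^-1 ^+ dist (z i) :> R.
      by apply: prodr_ge0 => i _; rewrite exprn_ge0.
    case: ifPn => [Qz|_]; last by rewrite mulr_ge0.
    rewrite prodrXr exprVn ler_pdivlMr ?exprn_gt0// mul1r.
    have -> : 8 ^+ n = 2 ^+ (3 * n) :> R.
      by rewrite exprM; congr (_ ^+ n); rewrite -natrX.
    by rewrite ler_weXn2l// ler1n.
  rewrite -mulr_sumr -(bigA_distr_bigA (fun (i : 'I_n) k => 2^-1 ^+ dist k)).
  have -> : 24 ^+ n = 8 ^+ n * 3 ^+ n :> R.
    by rewrite -exprMn; congr (_ ^+ n); rewrite -natrM.
  rewrite ler_pM2l ?exprn_gt0// -[n in leRHS]card_ord -prodr_const.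
  apply: ler_prod => i _; rewrite sum_half_pow_dist andbT.
  by apply: sumr_ge0 => k _; rewrite exprn_ge0.
apply: contrapT => /forallNP noz.
have small (z : {ffun 'I_n -> 'I_(M + M)}) : fine (W (cell s z)) <= 100^-1 ^+ n.
  apply: (@le_trans _ _ (fine (W (box s (lattice s z))))).
    apply: le_fine_prob; [exact: cell_measurable|exact: box_measurable|].
    exact: cell_sub_box.
  by have /negP := noz z; rewrite -ltNge => /ltW.
have : 4^-1 <= 24 ^+ n * 100^-1 ^+ n :> R.
  apply: (le_trans cover).
  apply: (@le_trans _ _ (\sum_(z | Q z) 1 * 100^-1 ^+ n)).
    by apply: ler_sum => z _; rewrite mul1r.
  by rewrite -mulr_suml ler_wpM2r// exprn_ge0.
rewrite -exprMn leNgt => /negP; apply.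
have q4 : 24 / 100 < 4^-1 :> R.
  by rewrite ltr_pdivrMr// mulrC ltr_pdivlMr// -natrM ltr_nat.
have q0' : 0 <= 24 / 100 :> R by rewrite divr_ge0.
have q1' : 24 / 100 <= 1 :> R by rewrite ler_pdivrMr// mul1r ler_nat.
apply: le_lt_trans q4; rewrite -[leRHS]expr1.
exact: ler_wiXn2l.
Qed.

End lattice.

(** * Halfspaces of small measure *)

Section separation.
Context {R : realType} {n : nat}.
Implicit Types (x y p u : 'rV[R]_n) (C : set 'rV[R]_n).

Lemma dotRn_ge0 x : 0 <= dotRn x x.
Proof. by apply: sumr_ge0 => i _; rewrite -expr2 sqr_ge0. Qed.

Lemma dotRn_eq0 x : dotRn x x = 0 -> x = 0.
Proof.
move=> /eqP; rewrite psumr_eq0 => [/allP x0|i _]; last by rewrite -expr2 sqr_ge0.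
apply/rowP => i; have := x0 i (mem_index_enum _).
by rewrite -expr2 sqrf_eq0 mxE => /eqP.
Qed.

Lemma dotRnBl x y u : dotRn (x - y) u = dotRn x u - dotRn y u.
Proof. by rewrite dotRnDl -scaleN1r dotRnZl mulN1r. Qed.

Lemma dotRn_sqrZB e x y : dotRn (e *: x - y) (e *: x - y) =
  e ^+ 2 * dotRn x x - 2 * e * dotRn x y + dotRn y y.
Proof.
rewrite /dotRn !mulr_sumr -sumrB -big_split/=.
by apply: eq_bigr => i _; rewrite !mxE; ring.
Qed.

(** [u = p - q] with [q] a point of [C] nearest to [p]. Midpoint convexity provides only the points
    at dyadic fractions of the segment from [q] to [y], which accumulate at [q]; that is enough for
    the variational inequality. *)
Lemma compact_midconvex_separation C p : compact C ->
  (forall x y, C x -> C y -> C (2^-1 *: (x + y))) -> ~ C p ->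
  exists u, forall y, dotRn p u <= dotRn y u -> ~ C y.
Proof.
move=> cC midC Cp.
have [C0|] := pselect (C !=set0); last first.
  by move=> C0; exists 0 => y _ Cy; apply: C0; exists y.
have [q /set_mem Cq qmin] : exists2 q, q \in C &
    forall t, t \in C -> dotRn (q - p) (q - p) <= dotRn (t - p) (t - p).
  apply: (@EVT_min_rV R n (fun y => dotRn (y - p) (y - p))) => //.
  apply: continuous_subspaceT; rewrite /dotRn.
  apply: continuous_big => [|i _]; first exact: add_continuous.
  have cc : continuous (fun y : 'rV[R]_n => (y - p) ord0 i).
    rewrite (_ : (fun _ => _) = (fun y : 'rV[R]_n => y ord0 i - p ord0 i)); last first.
      by apply/funext => y; rewrite !mxE.
    by move=> y; apply: continuousB; [exact: coord_continuous|exact: cst_continuous].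
  by move=> y; apply: continuousM; exact: cc.
have Cseg y k : C y -> C (q + 2^-1 ^+ k *: (y - q)).
  move=> Cy; elim: k => [|k ih]; first by rewrite expr0 scale1r addrC subrK.
  have := midC _ _ Cq ih; congr C; apply/rowP => i.
  by rewrite !mxE exprS; field.
exists (p - q) => y py Cy.
(* Minimality of [q] against the point at fraction [2^-1 ^+ k], expanded and divided by that
   fraction. *)
have h k : 2 * dotRn (y - q) (p - q) <= 2^-1 ^+ k * dotRn (y - q) (y - q).
  have e0 : 0 < 2^-1 ^+ k :> R by rewrite exprn_gt0.
  rewrite -(ler_pM2l e0).
  have := qmin _ (mem_set (Cseg y k Cy)).
  have -> : q + 2^-1 ^+ k *: (y - q) - p = 2^-1 ^+ k *: (y - q) - (p - q).
    by apply/rowP => i; rewrite !mxE; ring.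
  have -> : dotRn (q - p) (q - p) = dotRn (p - q) (p - q).
    by apply: eq_bigr => i _; rewrite !mxE; ring.
  rewrite dotRn_sqrZB expr2; move: (2^-1 ^+ k) e0 => e e0; lra.
have : dotRn (y - q) (p - q) <= 0.
  rewrite leNgt; apply/negP => d0.
  have D0 := dotRn_ge0 (y - q).
  have [D|D] := eqVneq (dotRn (y - q) (y - q)) 0.
    by have := h 0%N; rewrite D; lra.
  have {D} {}D0 : 0 < dotRn (y - q) (y - q) by rewrite lt0r D.
  have : (fun k => 2^-1 ^+ k : R) @ \oo --> (0 : R).
    by apply: cvg_expr; rewrite gtr0_norm// invf_lt1// ltr1n.
  move=> /cvgr_lt/(_ (dotRn (y - q) (p - q) / dotRn (y - q) (y - q))).
  rewrite divr_gt0// => /(_ isT)[N _ /(_ N (leqnn N))/=].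
  by rewrite ltr_pdivlMr// => hN; have := h N; lra.
have : 0 < dotRn (p - q) (p - q).
  rewrite lt0r dotRn_ge0 andbT; apply/eqP => /dotRn_eq0/eqP.
  by rewrite subr_eq0 => /eqP pq; apply: Cp; rewrite pq.
by move: py; rewrite !dotRnBl; lra.
Qed.

End separation.

Section halfspaces.
Context {R : realType} {n : nat}.
Implicit Types (W : probability (Rn R n) R) (x y p u : 'rV[R]_n).

(** Dual to the sup norm: [s * norm1 u] is the half-width of [box s x] in direction [u]. *)
Definition norm1 u := \sum_i `|u ord0 i|.

Lemma dotRn_box_le s x y u : box s x y -> `|dotRn y u - dotRn x u| <= s * norm1 u.
Proof.
move=> xy; rewrite -dotRnBl /norm1 mulr_sumr (le_trans (ler_norm_sum _ _ _))//.
by apply: ler_sum => i _; rewrite normrM ler_wpM2r// !mxE; exact: xy.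
Qed.

(** The halfspace separating [p] from the level set of the [3 * s]-boxes is enlarged by
    [s * norm1 u], so as to contain whole cells around [p]. Lattice boxes needed to cover it have
    measure below [rho ^ 2], and a heavy box bounds the sum of these measures. *)
Lemma halfspace_light W s M p (rho : R) :
  centered_variance W (s ^+ 2) -> mid_log_concave W -> 0 < s ->
  (0 < n)%N -> (0 < M)%N -> n%:R / M%:R ^+ 2 <= 4^-1 :> R -> 0 < rho ->
  fine (W (box (3 * s) p)) < rho ^+ 2 ->
  exists u, fine (W [set y : Rn R n | dotRn p u - s * norm1 u <= dotRn y u]) <=
    n%:R / M%:R ^+ 2 + rho * 50 ^+ n.
Proof.
move=> Wv Wlc s0 n0 M0 nM rho0 prho.
have rho20 : 0 < rho ^+ 2 by rewrite exprn_gt0.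
pose C := [set x | rho ^+ 2 <= fine (W (box (3 * s) x))].
have [||u pu] := @compact_midconvex_separation R n C p (compact_level_box Wv rho20).
- move=> x y Cx Cy; rewrite /C/=.
  have := box_mid_log_concave (3 * s) x y Wlc.
  move=> /(le_trans (ler_pM (ltW rho20) (ltW rho20) Cx Cy)).
  by rewrite -expr2 ler_sqr ?nnegrE ?fine_prob_ge0// ltW.
- by apply/negP; rewrite -ltNge.
exists u.
have [z0 z0h] := exists_heavy_box Wv s0 n0 M0 nM.
set H := [set y | _].
have mH : measurable (H : set (Rn R n)) by exact: halfspace_measurable.
pose Q (z : {ffun 'I_n -> 'I_(M + M)}) := fine (W (box s (lattice s z))) < rho ^+ 2.
have cover : fine (W H) <= fine (W (outside (s * M%:R))) +
    \sum_(z | Q z) fine (W (box s (lattice s z))).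
  pose B (z : option {ffun 'I_n -> 'I_(M + M)}) : set (Rn R n) :=
    if z is Some z then box s (lattice s z) else outside (s * M%:R).
  pose Q' (z : option {ffun 'I_n -> 'I_(M + M)}) := if z is Some z then Q z else true.
  have mB z : measurable (B z).
    by case: z => [z|]; [exact: box_measurable|exact: outside_measurable].
  have := @fine_prob_sum_cover _ _ _ W _ Q' H B mH mB.
  rewrite (bigD1 None)//=.
  rewrite [X in _ <= _ + X](_ : _ = \sum_(z | Q z) fine (W (box s (lattice s z)))); last first.
    rewrite (reindex_omap Some id); last by case.
    by apply: eq_bigl => z /=; rewrite eqxx !andbT.
  apply => y Hy.
  have [Oy|Oy] := pselect (outside (s * M%:R) y); first by exists None.
  have [z zy] := cell_cover s0 Oy; have {}zy := cell_sub_box zy.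
  exists (Some z) => //=; rewrite /Q.
  (* Moving by [2 * s] in the sign direction of [u] gains [2 * s * norm1 u]: one half undoes the
     enlargement of the halfspace, the other the distance from [y] to its lattice point. The
     [3 * s]-box around [x'] still contains the [s]-box of the lattice point. *)
  pose x' := lattice s z + \row_i (2 * s * Num.sg (u ord0 i)).
  have x'u : dotRn x' u = dotRn (lattice s z) u + 2 * s * norm1 u.
    rewrite dotRnDl; congr (_ + _); rewrite /norm1 mulr_sumr.
    by apply: eq_bigr => i _; rewrite mxE -mulrA -normrEsg.
  have : dotRn p u <= dotRn x' u.
    have := dotRn_box_le u zy; rewrite ler_distl => /andP[z1 z2].
    by move: Hy; rewrite /H/= x'u; lra.
  move=> /pu /negP; rewrite -ltNge; apply: le_lt_trans.
  apply: le_fine_prob; [exact: box_measurable|exact: box_measurable|].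
  move=> w zw i; have := zw i; rewrite !mxE.
  have : `|2 * s * Num.sg (u ord0 i)| <= 2 * s.
    rewrite normrM normr_sg ger0_norm; last by rewrite mulr_ge0// ltW.
    by rewrite -[leRHS]mulr1 ler_wpM2l ?mulr_ge0 ?lern1 ?leq_b1// ltW.
  rewrite !ler_norml => /andP[? ?] /andP[? ?].
  by apply/andP; split; lra.
apply: (le_trans cover); apply: lerD; first exact: outside_le.
pose F x := fine (W (box s x)).
have F0 x : 0 <= F x by exact: fine_prob_ge0.
have zF : 10^-1 ^+ n <= Num.sqrt (F (lattice s z0)).
  rewrite -[leLHS]ger0_norm ?exprn_ge0// -sqrtr_sqr ler_wsqrtr//.
  rewrite (le_trans _ z0h)// -exprM mulnC exprM.
  by rewrite (_ : 10^-1 ^+ 2 = 100^-1)// exprVn -natrX.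
(* Below [rho ^ 2], [F z <= rho * sqrt (F z)], and the heavy point gives
   [sqrt (F z) <= 10 ^ n * sqrt (F z * F z0)], which midpoint log-concavity bounds by [10 ^ n] times
   [F] at the midpoint. *)
apply: (@le_trans _ _ (\sum_(z : {ffun 'I_n -> 'I_(M + M)})
    rho * 10 ^+ n * F (2^-1 *: (lattice s z + lattice s z0)))).
  rewrite big_mkcond/=; apply: ler_sum => z _.
  have r0 : 0 <= rho * 10 ^+ n * F (2^-1 *: (lattice s z + lattice s z0)).
    by rewrite !mulr_ge0 ?exprn_ge0// ltW.
  case: ifPn => // Qz.
  have sq : Num.sqrt (F (lattice s z)) * Num.sqrt (F (lattice s z0)) <=
      F (2^-1 *: (lattice s z + lattice s z0)).
    rewrite -sqrtrM// -[leRHS]ger0_norm// -sqrtr_sqr ler_wsqrtr//.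
    exact: box_mid_log_concave.
  have Frho : Num.sqrt (F (lattice s z)) <= rho.
    rewrite -[leRHS]ger0_norm ?(ltW rho0)// -sqrtr_sqr ler_wsqrtr//.
    exact: ltW.
  rewrite -/(F _) -[leLHS]sqr_sqrtr// expr2 -mulrA.
  apply: ler_pM; rewrite ?sqrtr_ge0//.
  rewrite -ler_pdivrMl ?exprn_gt0// mulrC -exprVn.
  by apply: le_trans sq; rewrite ler_wpM2l// sqrtr_ge0.
rewrite -mulr_sumr -mulrA ler_pM2l//.
have -> : 50 ^+ n = 10 ^+ n * 5%:R ^+ n :> R.
  by rewrite -exprMn; congr (_ ^+ n); rewrite -natrM.
rewrite ler_pM2l ?exprn_gt0//.
(* The midpoints form a grid of spacing [s / 2], and [2 * s < 5 * (s / 2)] bounds the overlap by 5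
   per coordinate. *)
have s2 : 0 < s / 2 by rewrite divr_gt0.
have := @sum_box_le _ _ W (M + M)
  (fun i => s / 2 * ((z0 i)%:R - M%:R - M%:R)) (s / 2) s 5 s2.
have lt5 : 2 * s < 5%:R * (s / 2) by lra.
move=> /(_ lt5); apply: le_trans.
rewrite le_eqVlt; apply/orP; left; apply/eqP; apply: eq_bigr => z _.
congr (fine (W (box s _))); apply/rowP => i; rewrite !mxE.
by field.
Qed.

Lemma sum_box3_le W s M : 0 < s ->
  \sum_(z : {ffun 'I_n -> 'I_(M + M)}) fine (W (box (3 * s) (lattice s z)))
  <= 7 ^+ n.
Proof.
move=> s0; have lt7 : 2 * (3 * s) < 7%:R * s by lra.
have := @sum_box_le _ _ W (M + M) (fun i : 'I_n => - (s * M%:R)) s (3 * s) 7 s0 lt7.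
apply: le_trans; rewrite le_eqVlt; apply/orP; left; apply/eqP.
apply: eq_bigr => z _.
by congr (fine (W (box _ _))); apply/rowP => i; rewrite !mxE; ring.
Qed.

End halfspaces.

(** * Convex hulls of finitely many points *)

Section convex_hull.
Context {R : realType} {n : nat}.

(** The hull is the continuous image of the simplex of weights; compactness makes it Borel. *)
Lemma conv_hull_compact N (p : 'I_N -> 'rV[R]_n) :
  compact (conv_hull p : set 'rV[R]_n).
Proof.
pose S : set 'rV[R]_N := [set w | forall i, `[0, 1]%classic (w ord0 i)] `&`
  [set w | \sum_i w ord0 i = 1].
have cS : compact S.
  apply: compact_closedI.
    by apply: (@rV_compact R N (fun=> `[0, 1]%classic)) => i; exact: segment_compact.
  apply: (@closed_comp _ _ (fun w : 'rV[R]_N => \sum_i w ord0 i) [set 1]);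
    last exact: closed_eq.
  move=> w _; apply: continuous_big => [|i _]; first exact: add_continuous.
  exact: coord_continuous.
have -> : conv_hull p = (fun w : 'rV[R]_N => \sum_i w ord0 i *: p i) @` S.
  apply/seteqP; split => [x [w [w0 [w1 ->]]]|_ [w [w01 w1] <-]].
    exists (\row_i w i); last by apply: eq_bigr => i _; rewrite mxE.
    have e : \sum_i (\row_i w i) ord0 i = 1 by under eq_bigr do rewrite mxE.
    split => // i; rewrite /= in_itv/= mxE w0/= -w1 (bigD1 i)//= lerDl.
    exact: sumr_ge0.
  exists (fun i => w ord0 i); split => // i.
  by have := w01 i; rewrite /= in_itv/= => /andP[].
apply: continuous_compact => //; apply: continuous_subspaceT.
apply: continuous_big => [|i _]; first exact: add_continuous.
move=> w; apply: (@continuous_comp _ _ _ (fun w : 'rV[R]_N => w ord0 i) ( *:%R ^~ (p i))).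
  exact: coord_continuous.
exact: scalel_continuous.
Qed.

(** Otherwise all gaps [b - dotRn (p i) u] are positive with nonpositive weighted sum, so all
    weights vanish. *)
Lemma conv_hull_halfspace N (p : 'I_N -> 'rV[R]_n) x u b : conv_hull p x ->
  b <= dotRn x u -> exists i, b <= dotRn (p i) u.
Proof.
move=> [w [w0 [w1 ->]]] bx; apply: contrapT => /forallNP h.
have lt i : dotRn (p i) u < b by rewrite ltNge; apply/negP; exact: h.
have dE : dotRn (\sum_i w i *: p i) u = \sum_i w i * dotRn (p i) u.
  elim/big_ind2: _ => [|a c d e <- <-|i _].
  - by rewrite /dotRn big1// => i _; rewrite mxE mul0r.
  - by rewrite dotRnDl.
  - by rewrite dotRnZl.
have : \sum_i w i * (b - dotRn (p i) u) == 0.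
  rewrite eq_le sumr_ge0 ?andbT; last first.
    by move=> i _; rewrite mulr_ge0// subr_ge0 ltW.
  under eq_bigr do rewrite mulrBr.
  by rewrite sumrB -mulr_suml w1 mul1r -dE subr_le0.
rewrite psumr_eq0; last by move=> i _; rewrite mulr_ge0// subr_ge0 ltW.
move=> /allP wz; have : \sum_i w i = 0.
  apply: big1 => i _; have := wz i (mem_index_enum _).
  by rewrite mulf_eq0 subr_eq0 [_ == dotRn _ _]gt_eqF ?orbF// => /eqP.
by rewrite w1 => /eqP; rewrite oner_eq0.
Qed.

End convex_hull.

(** The integral of a nonnegative function is a supremum over simple functions below it, so it is
    monotone without measurability. The random variable [nu (conv_hull _)] is handled this way. *)
Lemma ge0_le_integral_any d (T : measurableType d) (R : realType)
    (mu : {measure set T -> \bar R}) (f g : T -> \bar R) :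
  (forall x, (0 <= f x)%E) -> (forall x, (f x <= g x)%E) ->
  (\int[mu]_x f x <= \int[mu]_x g x)%E.
Proof.
move=> f0 fg; rewrite !ge0_integralTE//; last first.
  by move=> x; rewrite (le_trans (f0 x)).
apply: le_ereal_sup => _ [h hf <-]; exists h => // x.
by rewrite (le_trans (hf x)).
Qed.

(** * Measure of boxes under a bounded density *)

Section density.
Context {R : realType} {n : nat}.
Variables (lam : {measure set (Rn R n) -> \bar R}) (nu : probability (Rn R n) R).
Variable f : Rn R n -> R.
Hypotheses (lamP : is_lebesgue_Rn lam) (fP : is_density lam nu f).

Let L := isotropic_constant lam f.

Lemma lebesgue_box (r : R) (x : 'rV[R]_n) : 0 <= r ->
  lam (box r x) = ((2 * r) ^+ n)%:E.
Proof.
move=> r0.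
pose a : 'rV[R]_n := \row_i (x ord0 i - r); pose b : 'rV[R]_n := \row_i (x ord0 i + r).
have -> : box r x = [set y : Rn R n | forall i,
    a ord0 i <= (y : 'rV[R]_n) ord0 i <= b ord0 i].
  by apply/seteqP; split => y /= h i; have := h i; rewrite !mxE ler_distl.
rewrite lamP => [|i]; last by rewrite !mxE; lra.
congr EFin; rewrite (eq_bigr (fun=> 2 * r)) ?prodr_const ?card_ord// => i _.
by rewrite !mxE; ring.
Qed.

(** [L ^ n] is the essential supremum of the density, and the box has volume [(2 * r) ^ n]. *)
Lemma density_box_le (r : R) (x : 'rV[R]_n) : (0 < n)%N -> 0 <= r -> L != 0 ->
  [/\ 0 < L & fine (nu (box r x)) <= (2 * L * r) ^+ n].
Proof.
move=> n0 r0 L0; have [mf [f0 nuE]] := fP.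
have n0' : n%:R != 0 :> R by rewrite pnatr_eq0 -lt0n.
(* A box of positive volume shows that [lam] is not the zero measure, for which the essential
   supremum would be minus infinity. *)
have E0 : (0 <= ess_sup lam (fun x => (f x)%:E))%E.
  apply: ess_sup_gee; last by apply: nearW => y; rewrite lee_fin.
  have : (0 < lam (box 1 (0 : 'rV[R]_n)))%E.
    by rewrite lebesgue_box// lte_fin exprn_gt0// mulr1.
  move=> /lt_le_trans; apply; apply: le_measure; rewrite ?inE//.
  exact: box_measurable.
have Efin : ess_sup lam (fun x => (f x)%:E) \is a fin_num.
  (* [fine] sends infinity to 0, so an infinite essential supremum would give [L = 0]. *)
  apply: contraNT L0 => Einf; rewrite /L /isotropic_constant.
  have -> : fine (ess_sup lam (fun x => (f x)%:E)) = 0.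
    by move: Einf; case: (ess_sup _ _).
  by rewrite powR0// invr_eq0.
have LE : L ^+ n = fine (ess_sup lam (fun x => (f x)%:E)).
  rewrite /L /isotropic_constant -powR_mulrn ?powR_ge0// -powRrM mulVf//.
  by rewrite powRr1// fine_ge0.
have Lpos : 0 < L by rewrite lt0r L0 powR_ge0.
split => //.
have mB := box_measurable r x.
rewrite -lee_fin prob_fineK// nuE//.
have -> : 2 * L * r = L * (2 * r) by ring.
rewrite exprMn EFinM -(@lebesgue_box r x)// -integral_cst//.
apply: ae_ge0_le_integral => //.
- by move=> y _; rewrite lee_fin.
- by apply/measurable_EFinP; exact: measurable_funTS.
- by move=> y _; rewrite lee_fin exprn_ge0// ltW.
have := ess_sup_ge lam (fun x => (f x)%:E).
by apply: filterS => y fy _; rewrite /cst LE fineK.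
Qed.

End density.

(** * The expected measure of a random polytope *)

Lemma quarter_le_expRN1 (R : realType) : 4^-1 <= expR (- 1) :> R.
Proof.
have -> : - 1 = 2%:R * - 2^-1 :> R by field.
rewrite expRM_natl; have h := expR_ge1Dx (- 2^-1 : R).
have : (2^-1 : R) ^+ 2 <= expR (- 2^-1) ^+ 2.
  rewrite lerXn2r ?nnegrE ?expR_ge0//; apply: le_trans h.
  by have -> : 1 - 2^-1 = 2^-1 :> R by field.
by apply: le_trans; rewrite exprVn -natrX.
Qed.

Lemma two_eighth_le_expR (R : realType) n : (0 < n)%N ->
  8^-1 ^+ n + 8^-1 ^+ n <= expR (- n%:R) :> R.
Proof.
move=> n0; rewrite -mulrN1 expRM_natl.
apply: (@le_trans _ _ (4^-1 ^+ n)); last first.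
  by rewrite lerXn2r ?nnegrE ?expR_ge0// quarter_le_expRN1.
have -> : 8^-1 = 4^-1 * 2^-1 :> R by rewrite -invfM -natrM.
rewrite exprMn -mulrDr -[leRHS]mulr1 ler_pM2l ?exprn_gt0//.
have : (2^-1 : R) ^+ n <= 2^-1 ^+ 1.
  by apply: ler_wiXn2l => //; rewrite invf_le1// ler1n.
by rewrite expr1; lra.
Qed.

Section random_polytope.
Context {R : realType} {n : nat}.
Variables (lam : {measure set (Rn R n) -> \bar R}) (mu nu : probability (Rn R n) R).
Variable f : Rn R n -> R.
Hypothesis n_gt0 : (0 < n)%N.
Hypotheses (lamP : is_lebesgue_Rn lam) (fP : is_density lam nu f).
Hypotheses (mu_mid : mid_log_concave mu) (mu_var : centered_variance mu 1).
Hypothesis nu_var : centered_variance nu 1.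

Let L := isotropic_constant lam f.
Hypothesis L_neq0 : L != 0.

(** At scale [s = 1] some box has [nu]-measure at least [100^-1 ^ n], while the density bound allows
    at most [(2 * L) ^ n]. *)
Lemma isotropic_constant_ge : 200^-1 <= L.
Proof.
pose M := (4 * n)%N; have M0 : (0 < M)%N by rewrite muln_gt0.
have nM : n%:R / M%:R ^+ 2 <= 4^-1 :> R.
  rewrite ler_pdivrMr ?exprn_gt0 ?ltr0n// mulrC ler_pdivlMr// -natrX -natrM ler_nat.
  by rewrite /M mulnC -[leqLHS]muln1 expnS expn1 leq_mul.
have nu_var1 : centered_variance nu (1 ^+ 2) by rewrite expr1n.
have [z hz] := exists_heavy_box nu_var1 ltr01 n_gt0 M0 nM.
have [L0 hL] := density_box_le lamP fP (lattice 1 z) n_gt0 ler01 L_neq0.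
have := le_trans hz hL; rewrite -/L mulr1 ler_pXn2r// ?nnegrE ?mulr_ge0 ?(ltW L0)//.
by rewrite -ler_pdivrMl// -invfM -natrM.
Qed.

Section scale.
Variable m : nat.
Let S : R := (2 ^ m)%:R.
(** Makes [(14 * 400 ^ 2 * L / s) ^ n <= 8^-1 ^ n] in [bad_cells]: [14 = 2 * 7] collects volume and
    overlap of boxes, [400 ^ 2] comes from [rho ^ 2], and [112 = 14 * 8]. *)
Hypothesis LS : (112 * 400 ^+ 2 * L) ^+ 2 <= S.

(** [s] is the standard deviation of the coordinates under [W]; [rho] makes
    [rho * 50 ^ n = 8^-1 ^ n] in [halfspace_light]; [M] is so large that [W] and [nu] give at most
    [8^-1 ^ n] to the outside of their lattice cubes. *)
Let s := Num.sqrt S.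
Let W := iter_conv m mu.
Let rho : R := 400^-1 ^+ n.
Let M := (Num.truncn (n%:R * S * 8 ^+ n)).+1.
Local Notation point := {ffun 'I_n -> 'I_(M + M)}.

Let S_ge1 : 1 <= S. Proof. by rewrite ler1n expn_gt0. Qed.
Let S_gt0 : 0 < S. Proof. exact: lt_le_trans S_ge1. Qed.
Let s_gt0 : 0 < s. Proof. by rewrite sqrtr_gt0. Qed.
Let s2 : s ^+ 2 = S. Proof. by rewrite sqr_sqrtr// ltW. Qed.
Let L_gt0 : 0 < L.
Proof. by rewrite (lt_le_trans _ isotropic_constant_ge) ?invr_gt0 ?ltr0n. Qed.

Let M_bound : n%:R * S / M%:R ^+ 2 <= 8^-1 ^+ n.
Proof.
have M1 : 1 <= M%:R :> R by rewrite ler1n.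
rewrite ler_pdivrMr ?exprn_gt0 ?ltr0n// exprVn [leRHS]mulrC ler_pdivlMr ?exprn_gt0//.
apply: (@le_trans _ _ M%:R); first exact/ltW/truncnS_gt.
by rewrite expr2 -[leLHS]mulr1 ler_pM2l// ltr0n.
Qed.

Let M_bound1 : n%:R / M%:R ^+ 2 <= 8^-1 ^+ n :> R.
Proof.
apply: le_trans M_bound; rewrite ler_wpM2r ?invr_ge0 ?exprn_ge0//.
by rewrite -[leLHS]mulr1 ler_wpM2l.
Qed.

Let M_bound4 : n%:R / M%:R ^+ 2 <= 4^-1 :> R.
Proof.
apply: (le_trans M_bound1); apply: (@le_trans _ _ (8^-1 ^+ 1)).
  by apply: ler_wiXn2l => //; rewrite invf_le1// ler1n.
by rewrite expr1 lef_pV2 ?posrE// ler_nat.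
Qed.

(** Two scales share the index [z]: lattice points of step [s], tested with [W], and cells of side
    [s / S], on the scale of [mu] and [nu]. *)
Let bad (z : point) := rho ^+ 2 <= fine (W (box (3 * s) (lattice s z))).

Let cell_halfspace (z : point) (u : 'rV[R]_n) :
  cell (s / S) z `<=`
  [set y | (dotRn (lattice s z) u - s * norm1 u) / S <= dotRn y u].
Proof.
move=> y /cell_sub_box zy /=.
rewrite ler_pdivrMr// [leRHS]mulrC -dotRnZl.
have Szy : box s (lattice s z) (S *: y).
  move=> i; have := zy i; rewrite !mxE.
  have -> : S * y ord0 i - s * ((z i)%:R - M%:R) =
      S * (y ord0 i - s / S * ((z i)%:R - M%:R)).
    by field; rewrite gt_eqF.
  rewrite normrM gtr0_norm// -(ler_pM2l S_gt0) => /le_trans; apply.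
  by rewrite mulrC divfK// gt_eqF.
by have := dotRn_box_le u Szy; rewrite ler_distl => /andP[].
Qed.

(** The power [2 ^ m] of the [mu]-measure is at most the [W]-measure of the dilated halfspace, hence
    at most [2 * 8^-1 ^ n <= expR (- n)]; then a root is taken. *)
Let good_halfspace (z : point) : ~~ bad z -> exists u,
  fine (mu [set y : Rn R n |
    (dotRn (lattice s z) u - s * norm1 u) / S <= dotRn y u]) <= expR (- (n%:R / S)).
Proof.
rewrite -ltNge => zb.
have [Wv Wlc] := iter_conv_props m n_gt0 mu_var mu_mid.
have Wv2 : centered_variance W (s ^+ 2) by rewrite s2.
have rho0 : 0 < rho by rewrite exprn_gt0 ?invr_gt0 ?ltr0n.
have [u hu] := halfspace_light Wv2 Wlc s_gt0 n_gt0 (ltn0Sn _) M_bound4 rho0 zb.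
exists u; set b := dotRn (lattice s z) u - s * norm1 u.
have Sb : (2 ^ m)%:R * (b / S) = b by rewrite mulrC divfK// gt_eqF.
have := iter_conv_halfspace mu m u (b / S); rewrite Sb => h.
have {h} : fine (mu [set y : Rn R n | b / S <= dotRn y u]) ^+ (2 ^ m) <=
    expR (- (n%:R / S)) ^+ (2 ^ m).
  apply: (le_trans h); apply: (le_trans hu).
  rewrite -expRM_natl mulrN.
  have -> : (2 ^ m)%:R * (n%:R / S) = n%:R by rewrite mulrC divfK// gt_eqF.
  apply: le_trans (two_eighth_le_expR R n_gt0); rewrite lerD//.
  rewrite /rho -exprMn; apply: lerXn2r;
    rewrite ?nnegrE ?mulr_ge0 ?invr_ge0 ?ler0n//.
  rewrite mulrC ler_pdivrMr ?ltr0n// [leRHS]mulrC ler_pdivlMr ?ltr0n//.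
  by rewrite -natrM ler_nat.
by rewrite ler_pXn2r ?nnegrE ?fine_prob_ge0 ?expR_ge0// expn_gt0.
Qed.

(** Bad boxes have [W]-measure at least [rho ^ 2] and the overlap is at most [7 ^ n], so there are
    at most [7 ^ n / rho ^ 2] of them; each cell has [nu]-measure at most
    [(2 * L * (s / S)) ^ n]. *)
Let bad_cells : \sum_(z | bad z) fine (nu (cell (s / S) z)) <= 8^-1 ^+ n.
Proof.
have t0 : 0 < s / S by rewrite divr_gt0.
have rho0 : 0 < rho ^+ 2 by rewrite !exprn_gt0 ?invr_gt0 ?ltr0n.
set q := (2 * L * (s / S)) ^+ n.
have q0 : 0 <= q by rewrite exprn_ge0 ?mulr_ge0 ?invr_ge0 ?(ltW L_gt0) ?(ltW s_gt0) ?(ltW S_gt0).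
have cq (z : point) : fine (nu (cell (s / S) z)) <= q.
  have [_] := density_box_le lamP fP (lattice (s / S) z) n_gt0 (ltW t0) L_neq0.
  apply: le_trans; apply: le_fine_prob; [exact: cell_measurable|exact: box_measurable|].
  exact: cell_sub_box.
apply: (@le_trans _ _ (\sum_(z : point) q / rho ^+ 2 *
    fine (W (box (3 * s) (lattice s z))))).
  rewrite big_mkcond/=; apply: ler_sum => z _.
  case: ifPn => [bz|_]; last by rewrite !mulr_ge0 ?fine_prob_ge0// invr_ge0 ltW.
  apply: (le_trans (cq z)); rewrite -mulrA -[leLHS]mulr1 ler_wpM2l//.
  by rewrite mulrC ler_pdivlMr// mul1r.
rewrite -mulr_sumr; apply: (@le_trans _ _ (q / rho ^+ 2 * 7 ^+ n)).
  by rewrite ler_wpM2l ?sum_box3_le// divr_ge0// ltW.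
have -> : q / rho ^+ 2 * 7 ^+ n = (14 * 400 ^+ 2 * L * (s / S)) ^+ n.
  rewrite /q /rho -exprM mulnC exprM -exprVn -!exprMn; congr (_ ^+ n).
  rewrite exprVn invrK (_ : 14 = 2 * 7 :> R); last by rewrite -natrM.
  by ring.
have D0 k : 0 <= k%:R * 400 ^+ 2 * L.
  by rewrite !mulr_ge0 ?exprn_ge0 ?ler0n ?(ltW L_gt0).
apply: lerXn2r; [|by rewrite nnegrE invr_ge0 ler0n|].
  by rewrite nnegrE mulr_ge0 ?D0 ?(ltW t0).
have Ls : 112 * 400 ^+ 2 * L <= s.
  by rewrite -ler_sqr ?nnegrE ?s2 ?(ltW s_gt0) ?D0.
have -> : s / S = s^-1 by rewrite -s2; field; rewrite gt_eqF.
rewrite ler_pdivrMr// [leRHS]mulrC ler_pdivlMr//; apply: le_trans Ls.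
rewrite (_ : 112 = 14 * 8 :> R); last by rewrite -natrM.
by rewrite le_eqVlt; apply/orP; left; apply/eqP; ring.
Qed.

Let outside_cells : fine (nu (outside (s / S * M%:R))) <= 8^-1 ^+ n.
Proof.
have a0 : 0 < s / S * M%:R by rewrite mulr_gt0 ?divr_gt0// ltr0n.
apply: (le_trans (outside_chebyshev nu_var a0)); apply: le_trans M_bound.
have -> : s / S = s^-1 by rewrite -s2; field; rewrite gt_eqF.
rewrite exprMn exprVn s2 invfM invrK mul1r mulrA.
by [].
Qed.

Variables (d : measure_display) (Omega : measurableType d).
Variables (P : probability Omega R) (X : nat -> Omega -> Rn R n).
Hypothesis X_mu : forall i, distributed_as P (X i) mu.

(** The first term pays for the bad cells and the outside. A good cell meets the hull only if one of
    [N] points falls into its halfspace, which is a union bound over [N] events of small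
    probability. *)
Lemma expected_polytope_le N :
  (\int[P]_w nu (conv_hull (fun k : 'I_N => (X k w : 'rV[R]_n))) <=
   (expR (- (n%:R / S)) + N%:R * expR (- (n%:R / S)))%:E)%E.
Proof.
have t0 : 0 < s / S by rewrite divr_gt0.
(* The halfspaces are fixed before the random points enter; 0 is a dummy value for bad [z]. *)
have /choice[u uP] : forall z : point, exists u : 'rV[R]_n, ~~ bad z ->
    fine (mu [set y : Rn R n |
      (dotRn (lattice s z) u - s * norm1 u) / S <= dotRn y u]) <= expR (- (n%:R / S)).
  move=> z; have [bz|/good_halfspace[u hu]] := boolP (bad z); last by exists u.
  by exists 0.
pose H (z : point) : set (Rn R n) :=
  [set y | (dotRn (lattice s z) (u z) - s * norm1 (u z)) / S <= dotRn y (u z)].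
have mH z : measurable (H z) by exact: halfspace_measurable.
have mXH k z : measurable (X k @^-1` H z).
  by rewrite -[Y in measurable Y]setTI; case: (X_mu k) => mX _; exact: mX.
pose c0 := fine (nu (outside (s / S * M%:R))) +
  \sum_(z : point | bad z) fine (nu (cell (s / S) z)).
have c00 : 0 <= c0.
  by rewrite addr_ge0 ?fine_prob_ge0// sumr_ge0// => z _; exact: fine_prob_ge0.
have c0_le : c0 <= expR (- (n%:R / S)).
  apply: (le_trans (lerD outside_cells bad_cells)).
  apply: (le_trans (two_eighth_le_expR R n_gt0)).
  by rewrite ler_expR lerN2 ler_pdivrMr// -[leLHS]mulr1 ler_wpM2l.
pose a (z : point) := if bad z then 0 else fine (nu (cell (s / S) z)).
have a0 z : 0 <= a z by rewrite /a; case: ifP => // _; exact: fine_prob_ge0.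
pose G w := c0 + \sum_(z : point) \sum_(k < N) a z * \1_(X k @^-1` H z) w.
have hull_le w : fine (nu (conv_hull (fun k : 'I_N => (X k w : 'rV[R]_n)))) <= G w.
  set K := conv_hull _.
  have mK : measurable K.
    by apply: compact_measurable_Rn; exact: conv_hull_compact.
  (* A cell meeting the hull has a sample point in its halfspace, because the halfspace contains the
     cell; bad cells are accounted for in [c0]. *)
  pose Q z := bad z || `[< exists k : 'I_N, H z (X k w) >].
  pose B (z : option point) : set (Rn R n) :=
    if z is Some z then cell (s / S) z else outside (s / S * M%:R).
  pose Q' (z : option point) := if z is Some z then Q z else true.
  have mB z : measurable (B z).
    by case: z => [z|]; [exact: cell_measurable|exact: outside_measurable].
  have := @fine_prob_sum_cover _ _ _ nu _ Q' K B mK mB.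
  rewrite (bigD1 None)//=.
  rewrite [Y in _ <= _ + Y](_ : _ = \sum_(z | Q z) fine (nu (cell (s / S) z))); last first.
    rewrite (reindex_omap Some id); last by case.
    by apply: eq_bigl => z /=; rewrite eqxx !andbT.
  move=> /(_ _)/le_trans; apply.
    move=> x Kx; have [Ox|Ox] := pselect (outside (s / S * M%:R) x).
      by exists None.
    have [z zx] := cell_cover t0 Ox; exists (Some z) => //=.
    apply/orP; right; apply/asboolP.
    exact: conv_hull_halfspace Kx (cell_halfspace (u z) zx).
  rewrite /G /c0 -addrA lerD2l.
  rewrite [Y in _ <= Y + _]big_mkcond/= -big_split/= [leLHS]big_mkcond/=.
  apply: ler_sum => z _; rewrite /Q /a.
  have sum0 (e : R) : 0 <= e -> 0 <= \sum_(k < N) e * \1_(X k @^-1` H z) w.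
    by move=> e0; apply: sumr_ge0 => k _; rewrite mulr_ge0.
  have [bz|bz] /= := boolP (bad z); first by rewrite lerDl sum0.
  rewrite add0r; case: asboolP => [[k Hk]|_]; last by rewrite sum0// fine_prob_ge0.
  rewrite (bigD1 k)//= indicE mem_set// mulr1 lerDl sumr_ge0// => j _.
  by rewrite mulr_ge0// fine_prob_ge0.
apply: (@le_trans _ _ (\int[P]_w (G w)%:E)%E).
  apply: ge0_le_integral_any => w //.
  have mK : measurable (conv_hull (fun k : 'I_N => (X k w : 'rV[R]_n))).
    by apply: compact_measurable_Rn; exact: conv_hull_compact.
  by rewrite -(prob_fineK nu mK) lee_fin.
have mterm z (k : 'I_N) : measurable_fun setT
    (fun w => (a z * \1_(X k @^-1` H z) w)%:E).
  by apply/measurable_EFinP; apply: measurable_funM => //; exact: measurable_indic.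
have term0 z (k : 'I_N) w : (0 <= (a z * \1_(X k @^-1` H z) w)%:E)%E.
  by rewrite lee_fin mulr_ge0.
have iterm z (k : 'I_N) : (\int[P]_w (a z * \1_(X k @^-1` H z) w)%:E =
    (a z * fine (mu (H z)))%:E)%E.
  under eq_integral do rewrite EFinM.
  rewrite ge0_integralZl//; last 2 first.
  - by apply/measurable_EFinP; exact: measurable_indic.
  - by rewrite lee_fin.
  rewrite integral_indic//= setIT; case: (X_mu k) => _ ->//.
  by rewrite EFinM (prob_fineK mu (mH z)).
have -> : (\int[P]_w (G w)%:E =
    (c0 + \sum_(z : point) \sum_(k < N) a z * fine (mu (H z)))%:E)%E.
  transitivity (\int[P]_w (c0%:E + \sum_(z : point) \sum_(k < N)
      (a z * \1_(X k @^-1` H z) w)%:E))%E.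
    apply: eq_integral => w _; rewrite /G EFinD; congr (_ + _)%E.
    by rewrite -sumEFin; apply: eq_bigr => z _; rewrite sumEFin.
  have msum z : measurable_fun setT (fun w => \sum_(k < N)
      (a z * \1_(X k @^-1` H z) w)%:E)%E by exact: emeasurable_sum.
  have sum0 z w : (0 <= \sum_(k < N) (a z * \1_(X k @^-1` H z) w)%:E)%E.
    exact: sume_ge0.
  rewrite ge0_integralD//; last 2 first.
  - by move=> w _; exact: sume_ge0.
  - exact: emeasurable_sum.
  rewrite (integral_cst_prob P) ge0_integral_sum//.
  rewrite [RHS]EFinD; congr (_ + _)%E.
  rewrite -sumEFin; apply: eq_bigr => z _.
  by rewrite ge0_integral_sum// -sumEFin; apply: eq_bigr => k _.
rewrite lee_fin lerD//.
(* Each good cell contributes its measure times [N * expR (- (n / S))], and the cells have total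
   measure at most 1. *)
apply: (@le_trans _ _ (\sum_(z : point) a z * (N%:R * expR (- (n%:R / S))))).
  apply: ler_sum => z _; rewrite sumr_const card_ord -[leLHS]mulr_natl mulrCA.
  rewrite /a; case: ifPn => [_|bz]; first by rewrite !mul0r.
  by rewrite ler_wpM2l ?fine_prob_ge0// ler_wpM2l// uP.
rewrite -mulr_suml -[leRHS]mul1r ler_wpM2r ?mulr_ge0 ?expR_ge0//.
apply: le_trans (sum_cell_le nu M t0); apply: ler_sum => z _.
by rewrite /a; case: ifP => // _; exact: fine_prob_ge0.
Qed.

End scale.
End random_polytope.

(** * Choice of the scale and of the constants *)

Lemma exists_pow2 (R : realType) (x : R) : 1 <= x ->
  exists m, x <= (2 ^ m)%:R <= 2 * x.
Proof.
move=> x1.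
have ex : exists m, x <= (2 ^ m)%:R.
  exists (Num.truncn x).+1; apply: (le_trans (ltW (truncnS_gt x))).
  by rewrite ler_nat ltnW// ltn_expl.
case: (ex_minnP ex) => m xm mmin; exists m; rewrite xm/=.
case: m xm mmin => [|m] xm mmin; first by rewrite expn0; lra.
have : (2 ^ m)%:R < x by rewrite ltNge; apply/negP => /mmin; rewrite ltnn.
by rewrite expnS natrM => /ltW; rewrite -(ler_pM2l (ltr0Sn R 1)).
Qed.

Theorem theorem5p1 (R : realType) :
  exists (c1 c2 : R) (n0 : nat), 0 < c1 /\ 0 < c2 /\
  forall (n : nat), (n0 <= n)%N ->
  forall (lam : {measure set (Rn R n) -> \bar R}), is_lebesgue_Rn lam ->
  forall (mu nu : probability (Rn R n) R),
    log_concave mu -> isotropic mu ->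
    log_concave nu -> isotropic nu ->
  forall (f : Rn R n -> R), is_density lam nu f ->
  forall (d : measure_display) (Omega : measurableType d)
         (P : probability Omega R) (X : nat -> Omega -> Rn R n),
    mutually_independent P X ->
    (forall i, distributed_as P (X i) mu) ->
  forall N : nat, (n < N)%N ->
    N%:R <= expR (c1 * n%:R / isotropic_constant lam f ^+ 2) ->
    (\int[P]_w nu (conv_hull (fun k : 'I_N => (X k w : 'rV[R]_n))) <=
      (2 * expR (- (c2 * n%:R / isotropic_constant lam f ^+ 2)))%:E)%E.
Proof.
have [D [DE D200]] : exists D : R, D = 112 * 400 ^+ 2 /\ 200 <= D.
  exists (112 * 400 ^+ 2); split; first reflexivity.
  rewrite -[leLHS]mul1r; apply: ler_pM; rewrite ?ler01 ?ler0n ?ler1n //.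
  apply: (@le_trans _ _ (400 : R)); first by rewrite ler_nat.
  by rewrite expr2 -[leLHS]mulr1 ler_pM2l ?ltr0n ?ler1n.
have D0 : 0 < D by apply: lt_le_trans D200; rewrite ltr0n.
(* As [S <= 2 * (D * L) ^ 2], this gives [n / S >= 2 * (c * n / L ^ 2)]: half of the exponent is
   spent on [N], half remains. *)
pose c : R := (4 * D ^+ 2)^-1.
have c0 : 0 < c by rewrite invr_gt0 mulr_gt0// exprn_gt0.
exists c, c, 1%N; do 2 split => //.
move=> n n0 lam lamP mu nu mulc muiso _ nuiso f fP d Omega P X _ Xmu N nN.
set L := isotropic_constant lam f => NL.
(* The value [L = 0], which also arises from an infinite essential supremum, contradicts the bound
   on [N]: division by 0 gives 0, so the bound reads [N <= 1], while [N > n >= 1]. *)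
have [L0|L0] := eqVneq L 0.
  move: NL; rewrite L0 expr0n/= invr0 mulr0 expR0 (ler_nat R N 1) => N1.
  by move: N1; rewrite leqNgt (leq_ltn_trans n0 nN).
have mu_var := isotropic_centered_variance muiso.
have nu_var := isotropic_centered_variance nuiso.
have mu_mid := log_concave_mid mulc.
have L200 : 200^-1 <= L by exact: isotropic_constant_ge lamP fP nu_var L0.
have Lpos : 0 < L by apply: lt_le_trans L200; rewrite invr_gt0 ltr0n.
(* [D >= 200] and [L >= 1/200] allow a power of two within a factor 2 above [(D * L) ^ 2]. *)
have DL1 : 1 <= (D * L) ^+ 2.
  rewrite -(expr1n _ 2) lerXn2r ?nnegrE ?mulr_ge0 ?(ltW D0) ?(ltW Lpos)//.
  have -> : 1 = 200 * 200^-1 :> R by rewrite divff ?pnatr_eq0.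
  by apply: ler_pM; rewrite ?invr_ge0 ?ler0n.
have [m /andP[mL Lm]] := exists_pow2 DL1.
rewrite DE in mL.
apply: (le_trans (expected_polytope_le n0 lamP fP mu_mid mu_var nu_var L0 mL Xmu N)).
set S : R := (2 ^ m)%:R.
have S0 : 0 < S by rewrite ltr0n expn_gt0.
have L20 : 0 < L ^+ 2 by rewrite exprn_gt0.
have nS : 2 * (c * n%:R / L ^+ 2) <= n%:R / S.
  have -> : 2 * (c * n%:R / L ^+ 2) = n%:R / (2 * (D * L) ^+ 2).
    by rewrite /c; field; rewrite !gt_eqF.
  by rewrite ler_wpM2l// lef_pV2 ?posrE ?mulr_gt0 ?exprn_gt0 ?mulr_gt0.
have e0 : 0 <= c * n%:R / L ^+ 2.
  by apply: divr_ge0; [apply: mulr_ge0; [exact: ltW|exact: ler0n]|exact: ltW].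
rewrite lee_fin [leRHS]mulr_natl mulr2n lerD//.
  by rewrite ler_expR lerN2; move: nS e0; lra.
apply: (le_trans (ler_wpM2r (expR_ge0 _) NL)).
by rewrite -expRD ler_expR; move: nS e0; lra.
Qed.
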